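(* Let $K\ge1$ and $0<\alpha<1$. Let $f=u+iv$ be a harmonic $K$-quasiregular mapping in the unit disk $\mathbb{D}$, where $u$ and $v$ are the real and imaginary parts of $f$, and suppose $u$ is continuous in $\overline{\mathbb{D}}$ (that is, $u$ extends continuously to $\overline{\mathbb{D}}$). If $u(e^{i\theta})\in\Lambda_\alpha$, then $v$ is continuous in $\overline{\mathbb{D}}$ (that is, $v$ extends continuously to $\overline{\mathbb{D}}$) and $v(e^{i\theta})\in\Lambda_\alpha$.
   Context: $\mathbb{D}=\{z\in\mathbb{C}:|z|<1\}$ and $\overline{\mathbb{D}}$ is its closure. For $\alpha>0$, $\Lambda_\alpha$ is the class of functions $\varphi:\mathbb{R}\to\mathbb{C}$ for which there is a constant $A>0$ with $|\varphi(x)-\varphi(y)|\le A|x-y|^\alpha$ for all $x,y\in\mathbb{R}$; the notation $u(e^{i\theta})\in\Lambda_\alpha$ means that the function $\theta\mapsto u(e^{i\theta})$ of boundary values belongs to $\Lambda_\alpha$. A complex-valued function $f=u+iv$ is harmonic in $\mathbb{D}$ if $u$ and $v$ are real-valued harmonic functions in $\mathbb{D}$. Every such $f$ has a unique representation $f=h+\overline{g}$ with $h,g$ analytic in $\mathbb{D}$ and $g(0)=0$. For $K\ge1$, a sense-preserving harmonic function $f=h+\overline{g}$ in $\mathbb{D}$ is called $K$-quasiregular if its complex dilatation $\omega=g'/h'$ satisfies $|\omega(z)|\le k<1$ for all $z\in\mathbb{D}$, where $k=\frac{K-1}{K+1}$. Sense-preserving is meant in the usual sense that $h'\not\equiv0$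 and $\omega=g'/h'$ is analytic in $\mathbb{D}$ (after removing removable singularities at zeros of $h'$) with $|\omega|<1$; no injectivity of $f$ is assumed. *)

(* Defs.v *)
From Stdlib Require Import Reals.
From Coquelicot Require Import Coquelicot.
Open Scope R_scope.

Definition disk (z : C) : Prop := Cmod z < 1.
Definition closed_disk (z : C) : Prop := Cmod z <= 1.

(* A function "on the disk" is a total function on [C] of which only the values
   on [disk] matter; as [disk] is open, derivatives and continuity at its points
   do not depend on the values outside. *)

(* [t ^ a] for [t >= 0] and [a > 0], with [0 ^ a = 0]: [Rpower 0 a] is 1. *)
Definition hpow (t a : R) : R :=
  if Req_EM_T t 0 then 0 else Rpower t a.

Definition Lambda (a : R) (phi : R -> C) : Prop :=
  exists A : R, 0 < A /\
    forall x y : R, Cmod (phi x - phi y)%C <= A * hpow (Rabs (x - y)) a.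

Definition expi (theta : R) : C := (cos theta, sin theta).

Definition continuous_extension (w W : C -> R) : Prop :=
  continuous_on closed_disk W /\ forall z, disk z -> W z = w z.

Definition partial_x (w : C -> R) (z : C) : R :=
  Derive (fun x : R => w (x, snd z)) (fst z).
Definition partial_y (w : C -> R) (z : C) : R :=
  Derive (fun y : R => w (fst z, y)) (snd z).

Definition C1_disk (w : C -> R) : Prop :=
  forall z : C, disk z ->
    ex_derive (fun x : R => w (x, snd z)) (fst z) /\
    ex_derive (fun y : R => w (fst z, y)) (snd z) /\
    continuous (partial_x w) z /\ continuous (partial_y w) z.

Definition C2_disk (w : C -> R) : Prop :=
  C1_disk w /\ C1_disk (partial_x w) /\ C1_disk (partial_y w).

Definition harmonic_real (w : C -> R) : Prop :=
  C2_disk w /\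
  forall z : C, disk z ->
    partial_x (partial_x w) z + partial_y (partial_y w) z = 0.

Definition harmonic (f : C -> C) : Prop :=
  harmonic_real (fun z => Re (f z)) /\ harmonic_real (fun z => Im (f z)).

(* [ex_derive] is taken over the field [C]: complex differentiability. *)
Definition analytic (f : C -> C) : Prop :=
  forall z : C, disk z -> @ex_derive C_AbsRing C_NormedModule f z.

Definition canonical_decomposition (f h g : C -> C) : Prop :=
  analytic h /\ analytic g /\ g (RtoC 0) = RtoC 0 /\
  forall z : C, disk z -> f z = (h z + Cconj (g z))%C.

(* [omega] is [g' / h'] with its (removable) singularities at the zeros of [h']
   filled in; since [h'] is not identically zero, these zeros are isolated and
   analyticity determines [omega] on [disk]. *)
Definition complex_dilatation (h g omega : C -> C) : Prop :=
  (exists z : C, disk z /\ C_derive h z <> RtoC 0) /\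
  analytic omega /\
  forall z : C, disk z -> C_derive h z <> RtoC 0 ->
    omega z = (C_derive g z / C_derive h z)%C.

Definition harmonic_quasiregular (K : R) (f : C -> C) : Prop :=
  harmonic f /\
  exists h g omega : C -> C,
    canonical_decomposition f h g /\
    complex_dilatation h g omega /\
    (forall z : C, disk z -> Cmod (omega z) < 1) /\
    (forall z : C, disk z -> Cmod (omega z) <= (K - 1) / (K + 1)).

(* Main.v *)
Require Import Defs.
From Stdlib Require Import Reals Lra Lia Psatz Classical ClassicalEpsilon.
From Coquelicot Require Import Coquelicot.
Open Scope R_scope.

(** Write [f = h + conj g], so that [u = Re (h + g)] and [v = Im (h - g)]. The dilatation
    bound [|g'| <= k |h'|] makes [|h' - g'| <= K |h' + g'|], that is, the gradient of [v]
    is at most [K] times the gradient of [u]. It therefore suffices to pass from the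
    boundary values of [u] to the growth of its gradient, and from the growth of the
    gradient of [v] back to a modulus of continuity of [v]:

    - if [u] is [alpha]-Hoelder on the circle, then [|grad u(z)| <= B (1 - |z|)^(alpha - 1)]
      ([gradient_growth]);
    - if [|grad v(z)| <= B (1 - |z|)^(alpha - 1)], then [v] is [alpha]-Hoelder on the disk
      ([hardy_littlewood]), hence extends with the same constant to the closed disk
      ([holder_extension]).

    The first step is usually read off the Poisson integral. Here it comes from the maximum
    principle ([maximum_principle]) and two explicit comparison functions. The harmonic
    function [Re (1 - z conj zeta)^alpha] is comparable to [|z - zeta|^alpha] on the circle,
    which gives [|u(z) - u(zeta)| <= C |z - zeta|^alpha] for [zeta] on the circle and [z] in
    the disk ([boundary_holder_upper]). So [u] oscillates by at most a multiple of
    [d^alpha] on the disk of radius [d / 2] about a point at distance [d] from the circle, and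
    an interior gradient estimate ([harmonic_gradient_bound]) finishes.

    The inequality [|g'| <= k |h'|] is immediate where [h'] does not vanish. At the zeros of
    [h'] it follows by continuity once these have empty interior, which is the identity
    theorem ([identity_theorem], [dilatation_bound]). It too is obtained from the maximum
    principle. The second derivatives this requires are supplied by the regularity of [u]
    and [v], so that no integral formula for analytic functions enters. *)

(** * Neighbourhoods in the plane and compactness *)

Lemma C_ball_iff (p q : C) (e : R) :
  ball p e q <-> Rabs (fst q - fst p) < e /\ Rabs (snd q - snd p) < e.
Proof. split; intros H; exact H. Qed.

Lemma Cmod_minus_sym (p q : C) : Cmod (p - q) = Cmod (q - p).
Proof. rewrite <- Cmod_opp. f_equal. ring. Qed.

Lemma locally_Cmod_lt (p c : C) (r : R) : Cmod (p - c) < r ->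
  locally p (fun q => Cmod (q - c) < r).
Proof.
  intros Hp.
  assert (Hs : 0 < sqrt 2) by (apply sqrt_lt_R0; lra).
  assert (He : 0 < (r - Cmod (p - c)) / sqrt 2) by (apply Rdiv_lt_0_compat; lra).
  exists (mkposreal _ He). intros q Hq.
  apply C_NormedModule_mixin_compat2 in Hq. simpl in Hq.
  replace (sqrt 2 * ((r - Cmod (p - c)) / sqrt 2)) with (r - Cmod (p - c)) in Hq by (field; lra).
  pose proof (Cmod_triangle (q - p) (p - c)) as Ht. replace (q - p + (p - c))%C with (q - c)%C in Ht by ring.
  change (minus q p) with (q - p)%C in Hq. lra.
Qed.

Lemma locally_Cmod_gt (p c : C) (r : R) : r < Cmod (p - c) ->
  locally p (fun q => r < Cmod (q - c)).
Proof.
  intros Hp.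
  assert (H : Cmod (p - p) < Cmod (p - c) - r).
  { replace (p - p)%C with (RtoC 0) by ring. rewrite Cmod_0. lra. }
  apply locally_Cmod_lt in H. revert H. apply filter_imp. intros q Hq.
  pose proof (Cmod_triangle (p - q) (q - c)) as Ht. replace (p - q + (q - c))%C with (p - c)%C in Ht by ring.
  rewrite (Cmod_minus_sym p q) in Ht. lra.
Qed.

Lemma locally_C_lt (z : C) (d : posreal) : locally z (fun p => Cmod (p - z) < d).
Proof.
  apply locally_Cmod_lt. replace (z - z)%C with (RtoC 0) by ring. rewrite Cmod_0. apply cond_pos.
Qed.

Lemma Cmod_le_sq (p : C) (r : R) : 0 <= r -> (Cmod p <= r <-> fst p ^ 2 + snd p ^ 2 <= r ^ 2).
Proof.
  intros Hr. pose proof (Cmod2_alt p) as E. unfold Re, Im in E. rewrite <- E.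
  pose proof (Cmod_ge_0 p). split; intros H1; [nra|].
  apply Rsqr_incr_0_var; [unfold Rsqr; lra|lra].
Qed.

(** Compactness in Lebesgue-number form: [Q p e] lets [p] choose the radius of its ball as a
    function of local data, and the conclusion bounds below the radii that are needed.
    A rectangle is compact for covers by boxes of arbitrary radii; the points outside the
    closed set [S] are given boxes that miss [S]. *)
Lemma compact_cover (S : C -> Prop) (B : R) (Q : C -> posreal -> Prop)
  (Sbounded : forall p, S p -> Cmod p <= B)
  (Sclosed : forall p, ~ S p -> locally p (fun q => ~ S q))
  (HQ : forall p, S p -> exists e, Q p e) :
  exists d : posreal, forall p, S p ->
    exists q e, S q /\ Q q e /\ ball q e p /\ d <= e.
Proof.
  assert (Hc : forall p : C, exists e : posreal,
     (S p -> Q p e) /\ (~ S p -> forall q, ball p e q -> ~ S q)).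
  { intros p. destruct (classic (S p)) as [Hp|Hp].
    - destruct (HQ p Hp) as [e He]. exists e. tauto.
    - destruct (Sclosed p Hp) as [e He]. exists e. split; [tauto|]. intros _. exact He. }
  pose (delta := fun x y : R =>
     proj1_sig (constructive_indefinite_description _ (Hc (x, y)))).
  destruct (compactness_value_2d (-B) B (-B) B delta) as [d Hd].
  exists d. intros p Hp. apply NNPP. intros Hn.
  pose proof (Rmax_Cmod p) as Hm. pose proof (Sbounded p Hp) as Hb.
  pose proof (Rmax_l (Rabs (fst p)) (Rabs (snd p))).
  pose proof (Rmax_r (Rabs (fst p)) (Rabs (snd p))).
  apply (Hd (fst p) (snd p)).
  - apply Rabs_le_between; lra.
  - apply Rabs_le_between; lra.
  - intros (u & v & Hu & Hv & H1 & H2 & H3). apply Hn.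
    unfold delta in H1, H2, H3.
    destruct (constructive_indefinite_description _ (Hc (u, v))) as [e [He1 He2]].
    simpl in H1, H2, H3.
    assert (Hball : ball (u, v) e p) by (apply C_ball_iff; split; assumption).
    destruct (classic (S (u, v))) as [Hs|Hs].
    + exists (u, v), e. auto.
    + exfalso. exact (He2 Hs p Hball Hp).
Qed.

Lemma continuous_on_lt (S : C -> Prop) (w : C -> R) (p : C) (c : R) :
  continuous_on S w -> S p -> w p < c ->
  exists e : posreal, forall q, ball p e q -> S q -> w q < c.
Proof.
  intros Hw Hp Hc.
  assert (Hlt : 0 < c - w p) by lra.
  destruct (proj1 (filterlim_locally _ _) (Hw p Hp) (mkposreal _ Hlt)) as [e He].
  exists e. intros q Hq Sq. specialize (He q Hq Sq).
  change (Rabs (w q - w p) < c - w p) in He.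
  apply Rabs_lt_between in He. lra.
Qed.

(** The radius at [p] is required to be at most [1 / (1 + |w p|)], so a lower bound on
    the radii in a cover bounds [w] at their centers. *)
Lemma bounded_on_compact (S : C -> Prop) (B : R) (w : C -> R)
  (Sbounded : forall p, S p -> Cmod p <= B)
  (Sclosed : forall p, ~ S p -> locally p (fun q => ~ S q))
  (Hw : continuous_on S w) :
  exists M, forall p, S p -> w p <= M.
Proof.
  destruct (compact_cover S B
    (fun p e => e * (1 + Rabs (w p)) <= 1 /\
                forall q, ball p e q -> S q -> w q < w p + 1)
    Sbounded Sclosed) as [d Hd].
  - intros p Hp.
    destruct (continuous_on_lt S w p (w p + 1) Hw Hp) as [e He]; [lra|].
    pose proof (Rabs_pos (w p)) as Ha.
    assert (Hi : 0 < / (1 + Rabs (w p))) by (apply Rinv_0_lt_compat; lra).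
    assert (Hm : 0 < Rmin e (/ (1 + Rabs (w p)))).
    { apply Rmin_pos; [apply cond_pos|exact Hi]. }
    exists (mkposreal _ Hm). simpl. split.
    + apply Rle_trans with (/ (1 + Rabs (w p)) * (1 + Rabs (w p))).
      * apply Rmult_le_compat_r; [lra|apply Rmin_r].
      * right. field. lra.
    + intros q Hq. apply He. apply ball_le with (2 := Hq). apply Rmin_l.
  - exists (/ d + 1). intros p Hp.
    destruct (Hd p Hp) as (q & e & Sq & [He1 He2] & Hb & Hde).
    specialize (He2 p Hb Hp).
    pose proof (cond_pos d) as Hdp. pose proof (Rle_abs (w q)).
    pose proof (Rabs_pos (w q)).
    assert (Rabs (w q) <= / d).
    { apply Rmult_le_reg_l with d; [lra|]. rewrite Rinv_r by lra. nra. }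
    lra.
Qed.

(** If the supremum [s] were not attained, every [q] would have a ball of radius at most
    [(s - w q) / 2] on which [w] stays below the midpoint of [w q] and [s]. A lower
    bound [d] on the radii in a cover would then make [s - d] an upper bound. *)
Lemma max_on_compact (S : C -> Prop) (B : R) (w : C -> R) (p0 : C)
  (Sbounded : forall p, S p -> Cmod p <= B)
  (Sclosed : forall p, ~ S p -> locally p (fun q => ~ S q))
  (Hw : continuous_on S w) (Hp0 : S p0) :
  exists q, S q /\ forall p, S p -> w p <= w q.
Proof.
  destruct (bounded_on_compact S B w Sbounded Sclosed Hw) as [M HM].
  destruct (completeness (fun y => exists p, S p /\ y = w p)) as [s [Hs1 Hs2]].
  { exists M. intros y (p & Hp & ->). auto. }
  { exists (w p0), p0. auto. }
  apply NNPP. intros Hn.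
  assert (Hlt : forall p, S p -> w p < s).
  { intros p Hp. destruct (Rle_lt_dec s (w p)) as [Hle|]; [|assumption].
    exfalso. apply Hn. exists p. split; [assumption|]. intros q Hq.
    apply Rle_trans with s; [|assumption]. apply Hs1. exists q. auto. }
  destruct (compact_cover S B
    (fun p e => e <= (s - w p) / 2 /\
                forall q, ball p e q -> S q -> w q < (s + w p) / 2)
    Sbounded Sclosed) as [d Hd].
  - intros p Hp. specialize (Hlt p Hp).
    destruct (continuous_on_lt S w p ((s + w p) / 2) Hw Hp) as [e He]; [lra|].
    assert (Hm : 0 < Rmin e ((s - w p) / 2)).
    { apply Rmin_pos; [apply cond_pos|lra]. }
    exists (mkposreal _ Hm). simpl. split; [apply Rmin_r|].
    intros q Hq. apply He. apply ball_le with (2 := Hq). apply Rmin_l.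
  - pose proof (cond_pos d).
    assert (s <= s - d); [|lra].
    apply Hs2. intros y (p & Hp & ->).
    destruct (Hd p Hp) as (q & e & Sq & [He1 He2] & Hb & Hde).
    specialize (He2 p Hb Hp). lra.
Qed.

(** * The maximum principle *)

(** The Laplacian as a relation that only asks for second derivatives along the two
    coordinate lines through [z], which is what a maximum of [w]
    controls. *)
Definition laplacian (w : C -> R) (z : C) (l : R) : Prop :=
  exists (wx wy : C -> R) (lx ly : R),
    locally z (fun p =>
      is_derive (fun x : R => w (x, snd p)) (fst p) (wx p) /\
      is_derive (fun y : R => w (fst p, y)) (snd p) (wy p)) /\
    is_derive (fun x : R => wx (x, snd z)) (fst z) lx /\
    is_derive (fun y : R => wy (fst z, y)) (snd z) ly /\
    l = lx + ly.

Lemma locally_line_x (P : C -> Prop) (z : C) :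
  locally z P -> locally (fst z) (fun x : R => P (x, snd z)).
Proof.
  intros [e He]. exists e. intros x Hx. apply He. apply C_ball_iff. simpl.
  split; [exact Hx|]. rewrite Rminus_diag, Rabs_R0. apply cond_pos.
Qed.

Lemma locally_line_y (P : C -> Prop) (z : C) :
  locally z P -> locally (snd z) (fun y : R => P (fst z, y)).
Proof.
  intros [e He]. exists e. intros x Hx. apply He. apply C_ball_iff. simpl.
  split; [|exact Hx]. rewrite Rminus_diag, Rabs_R0. apply cond_pos.
Qed.

Lemma laplacian_ext_loc (w1 w2 : C -> R) (z : C) (l : R) :
  locally z (fun p => w1 p = w2 p) -> laplacian w1 z l -> laplacian w2 z l.
Proof.
  intros He (wx & wy & lx & ly & Hloc & Hx & Hy & Hl).
  exists wx, wy, lx, ly. split; [|auto].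
  apply locally_locally in He.
  generalize (filter_and _ _ He Hloc). apply filter_imp.
  intros p [Hp [H1 H2]]. split.
  - apply is_derive_ext_loc with (2 := H1). exact (locally_line_x _ p Hp).
  - apply is_derive_ext_loc with (2 := H2). exact (locally_line_y _ p Hp).
Qed.

Lemma laplacian_plus (w1 w2 : C -> R) (z : C) (l1 l2 : R) :
  laplacian w1 z l1 -> laplacian w2 z l2 ->
  laplacian (fun p => w1 p + w2 p) z (l1 + l2).
Proof.
  intros (wx & wy & lx & ly & Hloc & Hx & Hy & Hl)
         (vx & vy & mx & my & Hloc' & Hx' & Hy' & Hl').
  exists (fun p => wx p + vx p), (fun p => wy p + vy p), (lx + mx), (ly + my).
  split; [|split; [|split]].
  - generalize (filter_and _ _ Hloc Hloc'). apply filter_imp.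
    intros p [[H1 H2] [H3 H4]]. split.
    + exact (is_derive_plus _ _ _ _ _ H1 H3).
    + exact (is_derive_plus _ _ _ _ _ H2 H4).
  - exact (is_derive_plus _ _ _ _ _ Hx Hx').
  - exact (is_derive_plus _ _ _ _ _ Hy Hy').
  - lra.
Qed.

Lemma laplacian_scal (k : R) (w : C -> R) (z : C) (l : R) :
  laplacian w z l -> laplacian (fun p => k * w p) z (k * l).
Proof.
  intros (wx & wy & lx & ly & Hloc & Hx & Hy & Hl).
  exists (fun p => k * wx p), (fun p => k * wy p), (k * lx), (k * ly).
  split; [|split; [|split]].
  - generalize Hloc. apply filter_imp. intros p [H1 H2].
    split; apply is_derive_scal; assumption.
  - apply is_derive_scal; assumption.
  - apply is_derive_scal; assumption.
  - rewrite Hl. ring.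
Qed.

Lemma laplacian_quadratic (k1 k2 k3 a b c : R) (z : C) :
  laplacian (fun p => k1 * (fst p - a) ^ 2 + k2 * (snd p - b) ^ 2 + k3 * (fst p - a) + c)
    z (2 * k1 + 2 * k2).
Proof.
  exists (fun p => 2 * k1 * (fst p - a) + k3), (fun p => 2 * k2 * (snd p - b)),
    (2 * k1), (2 * k2).
  split; [|split; [|split]].
  - apply filter_forall. intros p. simpl. split; auto_derive; trivial; ring.
  - simpl. auto_derive; trivial; ring.
  - simpl. auto_derive; trivial; ring.
  - ring.
Qed.

Lemma laplacian_const (c : R) (z : C) : laplacian (fun _ => c) z 0.
Proof.
  replace 0 with (2 * 0 + 2 * 0) by ring.
  apply laplacian_ext_loc with (2 := laplacian_quadratic 0 0 0 0 0 c z).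
  apply filter_forall. intros p. ring.
Qed.

(** The derivative vanishes at [t]; were [l] positive, it would be positive just to the right
    of [t], and [f] would exceed [f t] there. *)
Lemma second_derivative_at_max (f df : R -> R) (t l : R) :
  locally t (fun s => is_derive f s (df s)) -> is_derive df t l ->
  locally t (fun s => f s <= f t) -> l <= 0.
Proof.
  intros Hdf Hl Hmax.
  pose proof (locally_singleton _ _ Hdf) as H0.
  destruct Hmax as [e1 He1]. destruct Hdf as [e2 He2].
  pose proof (cond_pos e1) as P1. pose proof (cond_pos e2) as P2.
  assert (Hz : 0 <= df t).
  { apply Rnot_lt_le. intros Hneg. apply is_derive_Reals in H0.
    assert (Hn : 0 < - df t) by lra.
    destruct (H0 _ Hn) as [d Hd]. pose proof (cond_pos d).
    pose (h := - (Rmin e1 d / 2)).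
    pose proof (Rmin_pos e1 d P1 H). pose proof (Rmin_l e1 d). pose proof (Rmin_r e1 d).
    assert (Hh : h < 0) by (unfold h; lra).
    specialize (Hd h). rewrite (Rabs_left h) in Hd by lra.
    specialize (Hd ltac:(lra) ltac:(unfold h; lra)).
    apply Rabs_lt_between in Hd.
    assert (Hm : f (t + h) <= f t).
    { apply He1. change (Rabs (t + h - t) < e1).
      replace (t + h - t) with h by ring. rewrite Rabs_left by lra. unfold h; lra. }
    assert (0 <= (f (t + h) - f t) / h); [|lra].
    unfold Rdiv. replace ((f (t + h) - f t) * / h) with ((f t - f (t+h)) * / (- h)) by (field; lra).
    apply Rmult_le_pos; [lra|]. left. apply Rinv_0_lt_compat. lra. }
  apply Rnot_lt_le. intros Hpos. apply is_derive_Reals in Hl.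
  assert (Hn : 0 < l) by lra.
  destruct (Hl _ Hn) as [d Hd]. pose proof (cond_pos d) as P3.
  pose (h := Rmin e1 (Rmin e2 d) / 2).
  pose proof (Rmin_pos e1 _ P1 (Rmin_pos e2 d P2 P3)).
  pose proof (Rmin_l e1 (Rmin e2 d)). pose proof (Rmin_r e1 (Rmin e2 d)).
  pose proof (Rmin_l e2 d). pose proof (Rmin_r e2 d).
  assert (Hd' : forall s, t < s <= t + h -> 0 < df s).
  { intros s Hs. specialize (Hd (s - t)). rewrite (Rabs_right (s - t)) in Hd by lra.
    specialize (Hd ltac:(lra) ltac:(unfold h in Hs; lra)).
    replace (t + (s - t)) with s in Hd by ring.
    apply Rabs_lt_between in Hd.
    assert (0 < (df s - df t) / (s - t)) by lra.
    assert (0 < df s - df t).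
    { replace (df s - df t) with ((df s - df t) / (s - t) * (s - t)) by (field; lra).
      apply Rmult_lt_0_compat; lra. }
    lra. }
  assert (Hball : forall s, t <= s <= t + h -> ball t e2 s).
  { intros s Hs. change (Rabs (s - t) < e2). rewrite Rabs_right by lra. unfold h in Hs; lra. }
  assert (Hh : 0 < h) by (unfold h; lra).
  destruct (MVT_cor2 f df t (t + h)) as [c [Hc1 Hc2]]; [lra| |].
  { intros s Hs. apply is_derive_Reals. apply He2. apply Hball. lra. }
  pose proof (Hd' c ltac:(lra)).
  assert (f (t + h) <= f t).
  { apply He1. change (Rabs (t + h - t) < e1).
    replace (t + h - t) with h by ring. rewrite Rabs_right by lra. unfold h; lra. }
  nra.
Qed.

Lemma laplacian_at_max (w : C -> R) (z : C) (l : R) :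
  laplacian w z l -> locally z (fun p => w p <= w z) -> l <= 0.
Proof.
  intros (wx & wy & lx & ly & Hloc & Hx & Hy & Hl) Hm.
  assert (lx <= 0).
  { apply (second_derivative_at_max (fun x => w (x, snd z)) (fun x => wx (x, snd z)) (fst z)); auto.
    - generalize (locally_line_x _ z Hloc). apply filter_imp. simpl. tauto.
    - rewrite <- surjective_pairing. apply (locally_line_x _ z Hm). }
  assert (ly <= 0).
  { apply (second_derivative_at_max (fun y => w (fst z, y)) (fun y => wy (fst z, y)) (snd z)); auto.
    - generalize (locally_line_y _ z Hloc). apply filter_imp. simpl. tauto.
    - rewrite <- surjective_pairing. apply (locally_line_y _ z Hm). }
  lra.
Qed.

Lemma continuous_multR (f g : C -> R) (z : C) :
  continuous f z -> continuous g z -> continuous (fun p => f p * g p) z.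
Proof. intros Hf Hg. exact (continuous_mult f g z Hf Hg). Qed.

Lemma continuous_plusR (f g : C -> R) (z : C) :
  continuous f z -> continuous g z -> continuous (fun p => f p + g p) z.
Proof. intros Hf Hg. exact (continuous_plus f g z Hf Hg). Qed.

Lemma continuous_comp_derivable (f : C -> R) (g : R -> R) (z : C) :
  continuous f z -> ex_derive g (f z) -> continuous (fun p => g (f p)) z.
Proof.
  intros Hf Hg. apply (continuous_comp f g); [exact Hf|].
  apply (ex_derive_continuous g). exact Hg.
Qed.

Lemma continuous_coord (z : C) :
  continuous (fun p : C => fst p) z /\ continuous (fun p : C => snd p) z.
Proof. destruct z. split; [apply continuous_fst|apply continuous_snd]. Qed.

Lemma continuous_quadratic (k1 k2 k3 a b c : R) (z : C) :
  continuous (fun p : C => k1 * (fst p - a) ^ 2 + k2 * (snd p - b) ^ 2 + k3 * (fst p - a) + c) z.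
Proof.
  destruct (continuous_coord z) as [Hf Hs].
  apply continuous_plusR; [|apply continuous_const].
  apply continuous_plusR; [apply continuous_plusR|].
  - apply (continuous_comp_derivable _ (fun x => k1 * (x - a) ^ 2) z Hf). auto_derive. trivial.
  - apply (continuous_comp_derivable _ (fun x => k2 * (x - b) ^ 2) z Hs). auto_derive. trivial.
  - apply (continuous_comp_derivable _ (fun x => k3 * (x - a)) z Hf). auto_derive. trivial.
Qed.

Lemma continuous_on_plus (S : C -> Prop) (f g : C -> R) :
  continuous_on S f -> continuous_on S g -> continuous_on S (fun p => f p + g p).
Proof.
  intros Hf Hg p Hp.
  apply (filterlim_comp_2 f g Rplus (Hf p Hp) (Hg p Hp)).
  exact (filterlim_plus (f p) (g p)).
Qed.

(** Adding a small multiple of [|p|^2 - B^2], which is not positive on [S], makes the Laplacian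
    strictly positive at the interior points, so the maximum is not attained there. The
    boundary of [S] is not mentioned: it is whatever falls under the first alternative of
    [Hint]. *)
Lemma maximum_principle (S : C -> Prop) (B : R) (w : C -> R)
  (Sbounded : forall p, S p -> Cmod p <= B)
  (Sclosed : forall p, ~ S p -> locally p (fun q => ~ S q))
  (Hw : continuous_on S w)
  (Hint : forall p, S p -> w p <= 0 \/
     (locally p S /\ exists l, 0 <= l /\ laplacian w p l)) :
  forall p, S p -> w p <= 0.
Proof.
  intros p0 Hp0. apply Rnot_lt_le. intros Hpos.
  pose (e := w p0 / (2 * (1 + B ^ 2))).
  assert (HB : 0 < 1 + B ^ 2) by nra.
  assert (He : 0 < e).
  { unfold e. apply Rdiv_lt_0_compat; lra. }
  assert (HeB : e * B ^ 2 < w p0).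
  { assert (e * (1 + B ^ 2) = w p0 / 2) by (unfold e; field; lra). nra. }
  pose (k := fun p : C => w p +
    (e * (fst p - 0) ^ 2 + e * (snd p - 0) ^ 2 + 0 * (fst p - 0) + - e * B ^ 2)).
  assert (Hk : continuous_on S k).
  { apply continuous_on_plus; [exact Hw|]. apply continuous_on_forall.
    intros. apply continuous_quadratic. }
  destruct (max_on_compact S B k p0 Sbounded Sclosed Hk Hp0) as (q & Hq & Hmax).
  assert (Hmod : forall p : C, Cmod p ^ 2 = fst p ^ 2 + snd p ^ 2) by apply Cmod2_alt.
  assert (Hq0 : k q <= w q).
  { unfold k. pose proof (Hmod q). pose proof (Sbounded q Hq). pose proof (Cmod_ge_0 q).
    assert (Cmod q ^ 2 <= B ^ 2) by nra. nra. }
  assert (Hk0 : 0 < k p0).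
  { unfold k. pose proof (pow2_ge_0 (fst p0)). pose proof (pow2_ge_0 (snd p0)). nra. }
  pose proof (Hmax p0 Hp0).
  destruct (Hint q Hq) as [Hle|[Hloc (l & Hl0 & Hl)]]; [lra|].
  assert (l + (2 * e + 2 * e) <= 0); [|lra].
  apply (laplacian_at_max k q).
  - apply laplacian_plus; [exact Hl|apply laplacian_quadratic].
  - generalize Hloc. apply filter_imp. exact Hmax.
Qed.

(** * Functions satisfying the Cauchy-Riemann equations *)

(** A weak form of the complex derivative, by partial derivatives. It fits the definition of
    [laplacian], and unlike the complex derivative it can be read off directly for [h'],
    of which only the partial derivatives are known at first. *)
Definition cr_derive (f : C -> C) (z l : C) : Prop :=
  (is_derive (fun x : R => Re (f (x, snd z))) (fst z) (Re l) /\
   is_derive (fun x : R => Im (f (x, snd z))) (fst z) (Im l)) /\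
  (is_derive (fun y : R => Re (f (fst z, y))) (snd z) (- Im l) /\
   is_derive (fun y : R => Im (f (fst z, y))) (snd z) (Re l)).

Lemma laplacian_Re_cr (f f' : C -> C) (z l : C) :
  locally z (fun p => cr_derive f p (f' p)) -> cr_derive f' z l ->
  laplacian (fun p => Re (f p)) z 0.
Proof.
  intros Hloc [[H1 H2] [H3 H4]].
  exists (fun p => Re (f' p)), (fun p => - Im (f' p)), (Re l), (- Re l).
  split; [|split; [|split]].
  - generalize Hloc. apply filter_imp. unfold cr_derive. tauto.
  - exact H1.
  - apply (is_derive_opp _ _ _ H4).
  - ring.
Qed.

Lemma is_derive_mult_R (f g : R -> R) (x df dg : R) :
  is_derive f x df -> is_derive g x dg ->
  is_derive (fun t => f t * g t) x (df * g x + f x * dg).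
Proof. intros Hf Hg. apply (is_derive_mult f g x df dg Hf Hg). intros; apply Rmult_comm. Qed.

Lemma is_derive_eq (f : R -> R) (x l l' : R) : is_derive f x l -> l = l' -> is_derive f x l'.
Proof. intros H <-. exact H. Qed.

Lemma C_eta_f (f : C -> C) (p : C) : f (fst p, snd p) = f p.
Proof. destruct p; reflexivity. Qed.

Lemma cr_derive_const (c z : C) : cr_derive (fun _ => c) z 0.
Proof.
  split; split; simpl; apply is_derive_eq with 0; try apply (is_derive_const (V := R_NormedModule)); simpl; ring.
Qed.

Lemma cr_derive_mult (f g : C -> C) (z l m : C) :
  cr_derive f z l -> cr_derive g z m ->
  cr_derive (fun p => f p * g p)%C z (l * g z + f z * m)%C.
Proof.
  intros [[F1 F2] [F3 F4]] [[G1 G2] [G3 G4]]. split; split.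
  - eapply is_derive_eq.
    + exact (is_derive_minus _ _ _ _ _ (is_derive_mult_R _ _ _ _ _ F1 G1) (is_derive_mult_R _ _ _ _ _ F2 G2)).
    + cbv beta. rewrite !C_eta_f. unfold minus, plus, opp. destruct l, m, (f z), (g z). simpl. ring.
  - eapply is_derive_eq.
    + exact (is_derive_plus _ _ _ _ _ (is_derive_mult_R _ _ _ _ _ F1 G2) (is_derive_mult_R _ _ _ _ _ F2 G1)).
    + cbv beta. rewrite !C_eta_f. unfold minus, plus, opp. destruct l, m, (f z), (g z). simpl. ring.
  - eapply is_derive_eq.
    + exact (is_derive_minus _ _ _ _ _ (is_derive_mult_R _ _ _ _ _ F3 G3) (is_derive_mult_R _ _ _ _ _ F4 G4)).
    + cbv beta. rewrite !C_eta_f. unfold minus, plus, opp. destruct l, m, (f z), (g z). simpl. ring.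
  - eapply is_derive_eq.
    + exact (is_derive_plus _ _ _ _ _ (is_derive_mult_R _ _ _ _ _ F3 G4) (is_derive_mult_R _ _ _ _ _ F4 G3)).
    + cbv beta. rewrite !C_eta_f. unfold minus, plus, opp. destruct l, m, (f z), (g z). simpl. ring.
Qed.

Lemma cr_derive_plus (f g : C -> C) (z l m : C) :
  cr_derive f z l -> cr_derive g z m ->
  cr_derive (fun p => f p + g p)%C z (l + m)%C.
Proof.
  intros [[F1 F2] [F3 F4]] [[G1 G2] [G3 G4]]. split; split.
  - exact (is_derive_plus _ _ _ _ _ F1 G1).
  - exact (is_derive_plus _ _ _ _ _ F2 G2).
  - apply is_derive_eq with (- Im l + - Im m).
    + exact (is_derive_plus _ _ _ _ _ F3 G3).
    + destruct l, m; simpl; ring.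
  - exact (is_derive_plus _ _ _ _ _ F4 G4).
Qed.

Lemma cr_derive_eq (f : C -> C) (z l l' : C) : cr_derive f z l -> l = l' -> cr_derive f z l'.
Proof. intros H <-. exact H. Qed.

Lemma is_derive_inv_components (X Y : R -> R) (t dX dY : R) :
  is_derive X t dX -> is_derive Y t dY -> X t * X t + Y t * Y t <> 0 ->
  is_derive (fun s => X s / (X s ^ 2 + Y s ^ 2)) t
    ((dX * (Y t ^ 2 - X t ^ 2) - 2 * X t * Y t * dY) / (X t ^ 2 + Y t ^ 2) ^ 2) /\
  is_derive (fun s => - Y s / (X s ^ 2 + Y s ^ 2)) t
    ((dY * (Y t ^ 2 - X t ^ 2) + 2 * X t * Y t * dX) / (X t ^ 2 + Y t ^ 2) ^ 2).
Proof.
  intros HX HY Hn.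
  assert (EX : ex_derive X t) by (exists dX; exact HX).
  assert (EY : ex_derive Y t) by (exists dY; exact HY).
  assert (DX : Derive (fun s => X s) t = dX) by (apply is_derive_unique; exact HX).
  assert (DY : Derive (fun s => Y s) t = dY) by (apply is_derive_unique; exact HY).
  assert (Hn' : X t ^ 2 + Y t ^ 2 <> 0) by (intros E; apply Hn; rewrite <- E; ring).
  split; auto_derive; rewrite ?Rmult_1_r, ?DX, ?DY; repeat split; auto; field; auto.
Qed.

Lemma cr_derive_inv (f : C -> C) (z l : C) :
  cr_derive f z l -> f z <> 0 -> cr_derive (fun p => / f p)%C z (- l / (f z * f z))%C.
Proof.
  intros [[F1 F2] [F3 F4]] Hn.
  assert (Hn' : Re (f z) * Re (f z) + Im (f z) * Im (f z) <> 0).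
  { intros E. apply Hn. destruct (f z) as [a b]. simpl in E. unfold RtoC. f_equal; nra. }
  assert (E : (- l / (f z * f z))%C =
    ((Re l * (Im (f z) ^ 2 - Re (f z) ^ 2) - 2 * Re (f z) * Im (f z) * Im l) / (Re (f z) ^ 2 + Im (f z) ^ 2) ^ 2,
     (Im l * (Im (f z) ^ 2 - Re (f z) ^ 2) + 2 * Re (f z) * Im (f z) * Re l) / (Re (f z) ^ 2 + Im (f z) ^ 2) ^ 2)).
  { destruct l as [l1 l2], (f z) as [a b]; simpl in Hn' |- *.
    unfold Cdiv, Cmult, Cinv, Copp; simpl.
    assert (a * a + b * b <> 0) by exact Hn'.
    assert ((a * a - b * b) * (a * a - b * b) + (a * b + b * a) * (a * b + b * a) <> 0).
    { replace ((a * a - b * b) * (a * a - b * b) + (a * b + b * a) * (a * b + b * a)) with ((a * a + b * b) ^ 2) by ring.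
      apply pow_nonzero; assumption. }
    f_equal; field; split; assumption. }
  rewrite E.
  assert (E1 := is_derive_inv_components _ _ _ _ _ F1 F2). assert (E2 := is_derive_inv_components _ _ _ _ _ F3 F4).
  cbv beta in E1, E2. rewrite !C_eta_f in E1, E2.
  destruct (E1 Hn') as [A1 A2]. destruct (E2 Hn') as [A3 A4].
  split; split.
  - exact A1.
  - exact A2.
  - eapply is_derive_eq; [exact A3|]. simpl. unfold Rdiv. ring.
  - eapply is_derive_eq; [exact A4|]. simpl. unfold Rdiv. ring.
Qed.

(** * The boundary estimate *)

(** The principal branch of [w ^ alpha] on the right half-plane. *)
Definition cpower (alpha : R) (w : C) : C :=
  (exp (alpha / 2 * ln (Re w ^ 2 + Im w ^ 2)) * cos (alpha * atan (Im w / Re w)),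
   exp (alpha / 2 * ln (Re w ^ 2 + Im w ^ 2)) * sin (alpha * atan (Im w / Re w))).

Lemma is_derive_cpower_components (alpha : R) (X Y : R -> R) (t dX dY : R) :
  is_derive X t dX -> is_derive Y t dY -> 0 < X t ->
  let l := (alpha * (cpower alpha (X t, Y t) * / (X t, Y t)) * (dX, dY))%C in
  is_derive (fun s => Re (cpower alpha (X s, Y s))) t (Re l) /\
  is_derive (fun s => Im (cpower alpha (X s, Y s))) t (Im l).
Proof.
  intros HX HY Hp l.
  assert (EX : ex_derive X t) by (exists dX; exact HX).
  assert (EY : ex_derive Y t) by (exists dY; exact HY).
  assert (DX : Derive (fun s => X s) t = dX) by (apply is_derive_unique; exact HX).
  assert (DY : Derive (fun s => Y s) t = dY) by (apply is_derive_unique; exact HY).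
  unfold l, cpower. simpl.
  split; auto_derive; rewrite ?DX, ?DY.
  1, 3: repeat split; auto; nra.
  all: set (E := exp _); set (c := cos _); set (s := sin _); field; split; nra.
Qed.

Lemma cr_derive_cpower (alpha : R) (f : C -> C) (z l : C) :
  cr_derive f z l -> 0 < Re (f z) ->
  cr_derive (fun p => cpower alpha (f p)) z (alpha * (cpower alpha (f z) * / f z) * l)%C.
Proof.
  intros [[F1 F2] [F3 F4]] Hp.
  assert (E1 := is_derive_cpower_components alpha _ _ _ _ _ F1 F2).
  assert (E2 := is_derive_cpower_components alpha _ _ _ _ _ F3 F4).
  cbv beta zeta in E1, E2. rewrite !C_eta_f in E1, E2.
  destruct (E1 Hp) as [A1 A2]. destruct (E2 Hp) as [A3 A4]. clear E1 E2.
  assert (Eta : forall w : C, (Re w, Im w) = w) by (intros []; reflexivity).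
  rewrite (Eta (f z)) in A1, A2.
  split; split.
  - revert A1. apply is_derive_ext. intros t. rewrite Eta. reflexivity.
  - revert A2. apply is_derive_ext. intros t. rewrite Eta. reflexivity.
  - eapply is_derive_eq; [eapply is_derive_ext; [|exact A3]; intros t; cbv beta; rewrite Eta; reflexivity|].
    set (q := (alpha * (cpower alpha (f z) * / f z))%C). destruct q, l. simpl. ring.
  - eapply is_derive_eq; [eapply is_derive_ext; [|exact A4]; intros t; cbv beta; rewrite Eta; reflexivity|].
    set (q := (alpha * (cpower alpha (f z) * / f z))%C). destruct q, l. simpl. ring.
Qed.

Lemma continuous_Re_cpower (alpha : R) (f : C -> C) (z : C) :
  continuous (fun p => Re (f p)) z -> continuous (fun p => Im (f p)) z ->
  0 < Re (f z) -> continuous (fun p => Re (cpower alpha (f p))) z.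
Proof.
  intros Hr Hi Hp. unfold cpower. simpl. apply continuous_multR.
  - apply (continuous_comp_derivable
      (fun p => Re (f p) * (Re (f p) * 1) + Im (f p) * (Im (f p) * 1))
      (fun s => exp (alpha / 2 * ln s))).
    + apply continuous_plusR; apply continuous_multR; trivial;
        apply continuous_multR; trivial; apply continuous_const.
    + auto_derive. nra.
  - apply (continuous_comp_derivable (fun p => Im (f p) * / Re (f p))
      (fun s => cos (alpha * atan s))).
    + apply continuous_multR; trivial.
      apply (continuous_comp_derivable (fun p => Re (f p)) Rinv); trivial.
      auto_derive. lra.
    + auto_derive. trivial.
Qed.

Lemma Re_cpower_upper (alpha : R) (w : C) :
  Re (cpower alpha w) <= Rpower (Re w ^ 2 + Im w ^ 2) (alpha / 2).
Proof.
  unfold cpower, Rpower. simpl.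
  set (E := exp _). pose proof (exp_pos (alpha / 2 * ln (Re w * (Re w * 1) + Im w * (Im w * 1)))).
  fold E in H. pose proof (COS_bound (alpha * atan (Im w / Re w))). nra.
Qed.

(** The argument of [w] is at most [PI / 2] in absolute value, so that of [w ^ alpha] is at most
    [alpha * PI / 2 < PI / 2]: this is where [alpha < 1] enters the boundary estimate. *)
Lemma Re_cpower_lower (alpha : R) (w : C) : 0 < alpha < 1 ->
  cos (alpha * (PI / 2)) * Rpower (Re w ^ 2 + Im w ^ 2) (alpha / 2) <= Re (cpower alpha w).
Proof.
  intros Ha. unfold cpower, Rpower. simpl.
  set (E := exp _). pose proof (exp_pos (alpha / 2 * ln (Re w * (Re w * 1) + Im w * (Im w * 1)))).
  fold E in H. set (t := Im w / Re w).
  assert (cos (alpha * (PI / 2)) <= cos (alpha * atan t)); [|nra].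
  pose proof (atan_bound t). pose proof PI_RGT_0.
  assert (Hc : forall s, 0 <= s <= PI / 2 -> cos (alpha * (PI / 2)) <= cos (alpha * s)).
  { intros s Hs. apply cos_decr_1; nra. }
  destruct (Rle_dec 0 (atan t)).
  - apply Hc. lra.
  - rewrite <- (cos_neg (alpha * atan t)). replace (- (alpha * atan t)) with (alpha * - atan t) by ring.
    apply Hc. lra.
Qed.

(** The function [1 + eta - p * conj zeta] of [p]; for [|zeta| = 1] it maps the closed unit disk into the
    half-plane [Re w >= eta] and sends [zeta] to [eta]. *)
Definition half_plane_coord (eta : R) (zeta p : C) : C :=
  (1 + eta - (fst zeta * fst p + snd zeta * snd p), snd zeta * fst p - fst zeta * snd p).

Lemma cr_derive_half_plane_coord (eta : R) (zeta p : C) :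
  cr_derive (half_plane_coord eta zeta) p (- fst zeta, snd zeta).
Proof.
  unfold half_plane_coord. split; split; simpl; auto_derive; trivial; ring.
Qed.

Lemma continuous_half_plane_coord (eta : R) (zeta p : C) :
  continuous (fun q => Re (half_plane_coord eta zeta q)) p /\
  continuous (fun q => Im (half_plane_coord eta zeta q)) p.
Proof.
  destruct (continuous_coord p) as [Hf Hs].
  unfold half_plane_coord; simpl. split.
  - apply continuous_plusR; [apply continuous_const|].
    apply (continuous_opp (fun p : C => fst zeta * fst p + snd zeta * snd p)).
    apply continuous_plusR; apply continuous_multR; trivial; apply continuous_const.
  - apply continuous_plusR; [apply continuous_multR; trivial; apply continuous_const|].
    apply (continuous_opp (fun p : C => fst zeta * snd p)).
    apply continuous_multR; trivial; apply continuous_const.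
Qed.

Lemma laplacian_Re_cpower (alpha eta : R) (zeta z : C) :
  0 < fst (half_plane_coord eta zeta z) ->
  laplacian (fun p => Re (cpower alpha (half_plane_coord eta zeta p))) z 0.
Proof.
  intros Hp. set (W := half_plane_coord eta zeta) in *.
  pose proof (proj1 (continuous_half_plane_coord eta zeta z)) as Hc.
  assert (Hloc : locally z (fun p => 0 < fst (W p))).
  { apply (Hc (fun r => 0 < r)). apply open_gt. exact Hp. }
  set (m := (- fst zeta, snd zeta)).
  assert (HW : forall p, cr_derive W p m) by (intros; apply cr_derive_half_plane_coord).
  assert (Hn : W z <> 0).
  { intros E. rewrite E in Hp. simpl in Hp. lra. }
  apply (laplacian_Re_cr (fun p => cpower alpha (W p))
     (fun p => alpha * (cpower alpha (W p) * / W p) * m)%C z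
     ((0 * (cpower alpha (W z) * / W z) +
      alpha * ((alpha * (cpower alpha (W z) * / W z) * m) * / W z +
        cpower alpha (W z) * (- m / (W z * W z)))) * m +
       alpha * (cpower alpha (W z) * / W z) * 0)%C).
  - generalize Hloc. apply filter_imp. intros p Hp'. apply cr_derive_cpower; trivial.
  - apply (cr_derive_mult (fun p => alpha * (cpower alpha (W p) * / W p))%C (fun _ => m));
      [|apply cr_derive_const].
    apply (cr_derive_mult (fun _ => RtoC alpha)
      (fun p => cpower alpha (W p) * / W p)%C); [apply cr_derive_const|].
    apply (cr_derive_mult (fun p => cpower alpha (W p)) (fun p => / W p)%C).
    + apply cr_derive_cpower; trivial.
    + apply cr_derive_inv; trivial.
Qed.

Lemma half_plane_coord_norm (eta : R) (zeta p : C) : Cmod zeta = 1 ->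
  fst (half_plane_coord eta zeta p) ^ 2 + snd (half_plane_coord eta zeta p) ^ 2 =
  Cmod (p - zeta) ^ 2 + eta ^ 2 + 2 * eta * fst (half_plane_coord 0 zeta p).
Proof.
  intros Hz. assert (E : fst zeta ^ 2 + snd zeta ^ 2 = 1).
  { rewrite <- (Cmod2_alt zeta : _ = fst zeta ^ 2 + snd zeta ^ 2). rewrite Hz. ring. }
  rewrite Cmod2_alt. unfold half_plane_coord. destruct p as [x y], zeta as [a c]. simpl in *.
  replace ((x + - a) * ((x + - a) * 1) + (y + - c) * ((y + - c) * 1))
   with (x * x + y * y - 2 * (a * x + c * y) + (a * (a * 1) + c * (c * 1))) by ring.
  rewrite E.
  replace ((c * x - a * y) * ((c * x - a * y) * 1)) with
    ((x * x + y * y) * (a * (a * 1) + c * (c * 1)) - (a * x + c * y) * (a * x + c * y)) by ring.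
  rewrite E. ring.
Qed.

Lemma half_plane_coord_bounds (zeta p : C) : Cmod zeta = 1 -> Cmod p <= 1 ->
  0 <= fst (half_plane_coord 0 zeta p) <= Cmod (p - zeta).
Proof.
  intros Hz Hp.
  assert (E : fst zeta ^ 2 + snd zeta ^ 2 = 1).
  { rewrite <- (Cmod2_alt zeta : _ = fst zeta ^ 2 + snd zeta ^ 2). rewrite Hz. ring. }
  assert (E' : fst p ^ 2 + snd p ^ 2 <= 1).
  { rewrite <- (Cmod2_alt p : _ = fst p ^ 2 + snd p ^ 2). pose proof (Cmod_ge_0 p). nra. }
  split.
  - unfold half_plane_coord. destruct p as [x y], zeta as [a c]. simpl in *.
    pose proof (Rle_0_sqr (a - x)). pose proof (Rle_0_sqr (c - y)). unfold Rsqr in *. lra.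
  - pose proof (half_plane_coord_norm 0 zeta p Hz) as H.
    apply Rsqr_incr_0_var; [|apply Cmod_ge_0].
    pose proof (pow2_ge_0 (snd (half_plane_coord 0 zeta p))).
    unfold Rsqr. lra.
Qed.

Lemma hpow_pos (t a : R) : 0 < t -> hpow t a = Rpower t a.
Proof. intros H. unfold hpow. destruct (Req_EM_T t 0); [lra|reflexivity]. Qed.

Lemma hpow_0 (a : R) : hpow 0 a = 0.
Proof. unfold hpow. destruct (Req_EM_T 0 0); [reflexivity|lra]. Qed.

Lemma hpow_ge_0 (t a : R) : 0 <= hpow t a.
Proof. unfold hpow. destruct (Req_EM_T t 0); [lra|]. left. apply exp_pos. Qed.

Lemma hpow_le (s t a : R) : 0 < a -> 0 <= s <= t -> hpow s a <= hpow t a.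
Proof.
  intros Ha Hst. destruct (Req_dec s 0) as [->|Hs].
  - rewrite hpow_0. apply hpow_ge_0.
  - rewrite !hpow_pos by lra. apply Rle_Rpower_l; lra.
Qed.

Lemma hpow_mult (s t a : R) : 0 <= s -> 0 <= t -> hpow (s * t) a = hpow s a * hpow t a.
Proof.
  intros Hs Ht.
  destruct (Req_dec s 0) as [->|Hs0]. { rewrite Rmult_0_l, hpow_0. ring. }
  destruct (Req_dec t 0) as [->|Ht0]. { rewrite Rmult_0_r, hpow_0. ring. }
  rewrite !hpow_pos by nra. symmetry. apply Rpower_mult_distr; lra.
Qed.

Lemma Rpower_sq_half (t a : R) : 0 < t -> Rpower (t ^ 2) (a / 2) = Rpower t a.
Proof.
  intros Ht. rewrite <- Rpower_pow by lra. rewrite Rpower_mult. f_equal. simpl. field.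
Qed.

Lemma Cminus_0_r (p : C) : (p - 0)%C = p.
Proof. ring. Qed.

Lemma closed_disk_closed (p : C) : ~ closed_disk p -> locally p (fun q => ~ closed_disk q).
Proof.
  unfold closed_disk. intros Hp. apply Rnot_le_lt in Hp. rewrite <- (Cminus_0_r p) in Hp.
  generalize (locally_Cmod_gt p 0 1 Hp). apply filter_imp. intros q.
  rewrite Cminus_0_r. lra.
Qed.

Lemma locally_disk (p : C) : disk p -> locally p disk.
Proof.
  unfold disk. intros Hp. rewrite <- (Cminus_0_r p) in Hp.
  generalize (locally_Cmod_lt p 0 1 Hp). apply filter_imp. intros q.
  rewrite Cminus_0_r. trivial.
Qed.

Lemma disk_closed_disk (p : C) : disk p -> closed_disk p.
Proof. unfold disk, closed_disk. lra. Qed.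

Definition barrier_constant (alpha : R) : R := Rpower 2 alpha / cos (alpha * (PI / 2)).

Lemma cos_half_pos (alpha : R) : 0 < alpha < 1 -> 0 < cos (alpha * (PI / 2)).
Proof. intros Ha. pose proof PI_RGT_0. apply cos_gt_0; nra. Qed.

(** The barrier is [Re (w ^ alpha)] with [w = 1 + eta - p * conj zeta]. The shift by
    [eta = |z - zeta|] keeps the singularity [w = 0] off the closed disk; it only increases
    [|w|] on the circle, and at [z] it at most doubles it. *)
Lemma boundary_holder_upper (alpha A : R) (U : C -> R) (zeta z : C)
  (Halpha : 0 < alpha < 1) (HA : 0 <= A)
  (HU : continuous_on closed_disk U)
  (Hlap : forall p, disk p -> laplacian U p 0)
  (Hzeta : Cmod zeta = 1) (Hz : disk z)
  (Hb : forall p, Cmod p = 1 -> U p - U zeta <= A * hpow (Cmod (p - zeta)) alpha) :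
  U z - U zeta <= A * barrier_constant alpha * hpow (Cmod (z - zeta)) alpha.
Proof.
  pose proof (cos_half_pos alpha Halpha) as Hc. set (c0 := cos (alpha * (PI / 2))) in *.
  assert (Hd : 0 < Cmod (z - zeta)).
  { apply Cmod_gt_0. intros E. replace z with zeta in Hz; [unfold disk in Hz; lra|].
    replace zeta with (zeta + 0)%C by ring. rewrite <- E. ring. }
  set (eta := Cmod (z - zeta)) in *.
  set (W := half_plane_coord eta zeta).
  set (b := fun p => Re (cpower alpha (W p))).
  assert (HW : forall p, Cmod p <= 1 -> fst (W p) = eta + fst (half_plane_coord 0 zeta p)).
  { intros. unfold W, half_plane_coord. simpl. ring. }
  assert (HWpos : forall p, Cmod p <= 1 -> 0 < fst (W p)).
  { intros p Hp. rewrite (HW p Hp). pose proof (half_plane_coord_bounds zeta p Hzeta Hp). lra. }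
  assert (Hmain : forall p, closed_disk p -> U p + (- (A / c0) * b p + - U zeta) <= 0).
  { apply (maximum_principle closed_disk 1).
    - intros p Hp. exact Hp.
    - apply closed_disk_closed.
    - apply continuous_on_plus; [exact HU|].
      apply continuous_on_plus; [|apply continuous_on_forall; intros; apply continuous_const].
      intros p Hp. apply (filterlim_filter_le_1 (F := locally p) _ (filter_le_within _)).
      apply (continuous_multR (fun _ => - (A / c0)) b); [apply continuous_const|].
      destruct (continuous_half_plane_coord eta zeta p).
      apply continuous_Re_cpower; trivial. apply HWpos. exact Hp.
    - intros p Hp. destruct (Rle_lt_or_eq_dec (Cmod p) 1 Hp) as [Hlt|Heq].
      + right. split.
        * generalize (locally_disk p Hlt). apply filter_imp. apply disk_closed_disk.
        * exists (0 + (- (A / c0) * 0 + 0)). split; [right; ring|].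
          apply (laplacian_plus U (fun p => - (A / c0) * b p + - U zeta)).
          -- exact (Hlap p Hlt).
          -- apply (laplacian_plus (fun p => - (A / c0) * b p) (fun _ => - U zeta)).
             ++ apply laplacian_scal. apply laplacian_Re_cpower. apply HWpos. exact Hp.
             ++ apply laplacian_const.
      + left. assert (Hbp : c0 * hpow (Cmod (p - zeta)) alpha <= b p).
        { pose proof (Re_cpower_lower alpha (W p) Halpha) as Hl. fold c0 in Hl.
          apply Rle_trans with (2 := Hl). apply Rmult_le_compat_l; [lra|].
          pose proof (half_plane_coord_norm eta zeta p Hzeta) as Hn. fold W in Hn.
          pose proof (half_plane_coord_bounds zeta p Hzeta Hp) as Hbd.
          unfold Re, Im. rewrite Hn.
          destruct (Req_dec (Cmod (p - zeta)) 0) as [E|E].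
          - rewrite E, hpow_0. left. apply exp_pos.
          - pose proof (Cmod_ge_0 (p - zeta)).
            rewrite hpow_pos by lra. rewrite <- Rpower_sq_half by lra.
            apply Rle_Rpower_l; [lra|]. split; [nra|]. nra. }
        specialize (Hb p Heq).
        assert (A * hpow (Cmod (p - zeta)) alpha <= A / c0 * b p).
        { replace (A * hpow (Cmod (p - zeta)) alpha) with
           (A / c0 * (c0 * hpow (Cmod (p - zeta)) alpha)) by (field; lra).
          apply Rmult_le_compat_l; [|exact Hbp].
          unfold Rdiv. apply Rmult_le_pos; [lra|]. left. apply Rinv_0_lt_compat. lra. }
        lra. }
  specialize (Hmain z (disk_closed_disk z Hz)).
  assert (Hbz : b z <= Rpower 2 alpha * hpow eta alpha).
  { apply Rle_trans with (1 := Re_cpower_upper alpha (W z)).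
    rewrite hpow_pos by lra. rewrite Rpower_mult_distr by lra.
    rewrite <- (Rpower_sq_half (2 * eta)) by lra.
    pose proof (half_plane_coord_norm eta zeta z Hzeta) as Hn. fold W in Hn.
    pose proof (half_plane_coord_bounds zeta z Hzeta (disk_closed_disk z Hz)) as Hbd.
    unfold Re, Im. rewrite Hn. fold eta. fold eta in Hbd.
    apply Rle_Rpower_l; [lra|]. split; nra. }
  unfold barrier_constant. fold c0.
  assert (A / c0 * b z <= A * (Rpower 2 alpha / c0) * hpow eta alpha); [|lra].
  replace (A * (Rpower 2 alpha / c0) * hpow eta alpha) with
    (A / c0 * (Rpower 2 alpha * hpow eta alpha)) by (field; lra).
  apply Rmult_le_compat_l; [|exact Hbz].
  unfold Rdiv. apply Rmult_le_pos; [lra|]. left. apply Rinv_0_lt_compat. lra.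
Qed.

(** * Interior gradient estimate *)

Definition reflect_x (a : R) (p : C) : C := (2 * a - fst p, snd p).

Lemma locally_reflect (a : R) (p : C) (P : C -> Prop) :
  locally (reflect_x a p) P -> locally p (fun q => P (reflect_x a q)).
Proof.
  intros [e He]. exists e. intros q Hq. apply He. apply C_ball_iff in Hq. apply C_ball_iff.
  destruct Hq as [H1 H2]. simpl. split; [|exact H2].
  replace (2 * a - fst q - (2 * a - fst p)) with (- (fst q - fst p)) by ring.
  rewrite Rabs_Ropp. exact H1.
Qed.

Lemma is_derive_reflect (f : R -> R) (a x l : R) :
  is_derive f (2 * a - x) l -> is_derive (fun t => f (2 * a - t)) x (- l).
Proof.
  intros H. replace (- l) with (scal (-1) l) by (unfold scal; simpl; unfold mult; simpl; ring).
  apply (is_derive_comp f (fun t => 2 * a - t)); [exact H|].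
  auto_derive; trivial; ring.
Qed.

Lemma laplacian_reflect (u : C -> R) (a : R) (p : C) (l : R) :
  laplacian u (reflect_x a p) l -> laplacian (fun q => u (reflect_x a q)) p l.
Proof.
  intros (wx & wy & lx & ly & Hloc & Hx & Hy & Hl).
  exists (fun q => - wx (reflect_x a q)), (fun q => wy (reflect_x a q)), lx, ly.
  split; [|split; [|split]].
  - apply locally_reflect in Hloc. revert Hloc. apply filter_imp.
    intros q [H1 H2]. split; [|exact H2].
    apply (is_derive_reflect (fun x => u (x, snd q)) a (fst q)). exact H1.
  - replace lx with (- - lx) by ring.
    apply (is_derive_opp (fun x => wx (reflect_x a (x, snd p)))).
    apply (is_derive_reflect (fun x => wx (x, snd p)) a (fst p)). exact Hx.
  - exact Hy.
  - exact Hl.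
Qed.

Lemma derive_le_of_right_slope (g : R -> R) (l k d : R) :
  0 < d -> is_derive g 0 l -> (forall t, 0 < t < d -> g t - g 0 <= k * t) -> l <= k.
Proof.
  intros Hd Hg Hle. apply is_derive_Reals in Hg. apply Rnot_lt_le. intros Hlt.
  assert (He : 0 < l - k) by lra. destruct (Hg _ He) as [e Hge].
  pose proof (cond_pos e) as Pe. pose (t := Rmin d e / 2).
  pose proof (Rmin_pos d e Hd Pe). pose proof (Rmin_l d e). pose proof (Rmin_r d e).
  assert (Ht : 0 < t < d) by (unfold t; lra).
  specialize (Hge t ltac:(lra)). rewrite Rabs_right in Hge by lra.
  specialize (Hge ltac:(unfold t; lra)). rewrite Rplus_0_l in Hge.
  apply Rabs_lt_between in Hge. specialize (Hle t Ht).
  assert ((g t - g 0) / t <= k); [|lra].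
  apply Rle_div_l; lra.
Qed.

(** The odd part of [u] with respect to the vertical line through [z] vanishes on that line and
    is at most [M] elsewhere. With [p - z = (x, y)], on the right half of the disk it is
    therefore dominated by [M (|p - z|^2 / r^2 + 2 (x / r) (1 - x / r))]: this function is
    harmonic, is at least [M] on the arc and nonnegative on the diameter, and its slope in
    the [x] direction at the center is [2 M / r]. *)
Lemma harmonic_partial_x_upper (u : C -> R) (z : C) (r M c l : R)
  (Hr : 0 < r)
  (Hcont : forall p, Cmod (p - z) <= r -> continuous u p)
  (Hlap : forall p, Cmod (p - z) <= r -> laplacian u p 0)
  (HM : forall p, Cmod (p - z) <= r -> Rabs (u p - c) <= M)
  (Hl : is_derive (fun x => u (x, snd z)) (fst z) l) :
  l <= 2 * M / r.
Proof.
  set (a := fst z). set (b := snd z).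
  set (S := fun p : C => Cmod (p - z) <= r /\ a <= fst p).
  set (q := fun p : C => M / r ^ 2 * (fst p - a) ^ 2 + - (M / r ^ 2) * (snd p - b) ^ 2 +
     - (2 * M / r) * (fst p - a) + 0).
  set (w := fun p => (1 / 2 * u p + - (1 / 2) * u (reflect_x a p)) + q p).
  assert (Hrefl : forall p, Cmod (reflect_x a p - z) = Cmod (p - z)).
  { intros p. apply Rsqr_inj; try apply Cmod_ge_0. unfold Rsqr.
    assert (E : forall x : R, x * x = x ^ 2) by (intros; ring). rewrite !E, !Cmod2_alt.
    unfold a. destruct p, z. simpl. ring. }
  assert (HM0 : 0 <= M).
  { apply Rle_trans with (2 := HM z ltac:(replace (z - z)%C with (RtoC 0) by ring; rewrite Cmod_0; lra)).
    apply Rabs_pos. }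
  assert (Hodd : forall p, Cmod (p - z) <= r -> 1 / 2 * u p + - (1 / 2) * u (reflect_x a p) <= M).
  { intros p Hp. pose proof (HM p Hp) as H1. pose proof (HM (reflect_x a p)) as H2.
    rewrite Hrefl in H2. specialize (H2 Hp). apply Rabs_le_between in H1, H2. lra. }
  assert (Hcmp : forall p, S p -> w p <= 0).
  { apply (maximum_principle S (Cmod z + r)).
    - intros p [Hp _]. pose proof (Cmod_triangle z (p - z)) as Ht.
      replace (z + (p - z))%C with p in Ht by ring. lra.
    - intros p Hp. destruct (Rle_lt_dec (Cmod (p - z)) r) as [H1|H1].
      + assert (H2 : fst p < a).
        { apply Rnot_le_lt. intros H2. apply Hp. split; assumption. }
        destruct (continuous_coord p) as [Hf _].
        generalize (Hf (fun x => x < a) (open_lt a (fst p) H2)).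
        apply (filter_imp (fun q : C => fst q < a)). intros p' H3 [_ H4]. lra.
      + generalize (locally_Cmod_gt p z r H1). apply filter_imp. intros p' H3 [H4 _]. lra.
    - intros p [Hp _].
      apply (filterlim_filter_le_1 (F := locally p) _ (filter_le_within _)).
      apply continuous_plusR; [|apply continuous_quadratic].
      apply continuous_plusR; apply continuous_multR; try apply continuous_const.
      + apply Hcont. exact Hp.
      + apply (filterlim_comp _ _ _ (reflect_x a) u _ (locally (reflect_x a p))).
        * intros P HP. apply locally_reflect. exact HP.
        * apply Hcont. rewrite Hrefl. exact Hp.
    - intros p [Hp Ha].
      destruct (Rle_lt_or_eq_dec _ _ Hp) as [Hlt|Heq];
      [destruct (Rle_lt_or_eq_dec _ _ Ha) as [Hlt'|Heq']|].
      + right. split.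
        * destruct (continuous_coord p) as [Hf _].
          generalize (Hf (fun x => a < x) (open_gt a (fst p) Hlt')). intros H1.
          generalize (filter_and _ _ (locally_Cmod_lt p z r Hlt) H1).
          apply filter_imp. intros p' [H2 H3]. split; [lra|]. left. exact H3.
        * exists ((1 / 2 * 0 + - (1 / 2) * 0) + (2 * (M / r ^ 2) + 2 * - (M / r ^ 2))).
          split; [lra|].
          apply (laplacian_plus (fun p => 1 / 2 * u p + - (1 / 2) * u (reflect_x a p)) q);
            [|apply laplacian_quadratic].
          apply (laplacian_plus (fun p => 1 / 2 * u p) (fun p => - (1 / 2) * u (reflect_x a p))).
          -- apply laplacian_scal. apply Hlap. exact Hp.
          -- apply (laplacian_scal (- (1 / 2)) (fun p => u (reflect_x a p))).
             apply laplacian_reflect. apply Hlap. rewrite Hrefl. exact Hp.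
      + left. unfold w, q. rewrite <- Heq'.
        replace (reflect_x a p) with p.
        2: { unfold reflect_x. destruct p. simpl in *. f_equal. lra. }
        pose proof (pow2_ge_0 (snd p - b)).
        assert (0 <= M / r ^ 2). { apply Rmult_le_pos; [lra|]. left. apply Rinv_0_lt_compat. nra. }
        nra.
      + left. unfold w. specialize (Hodd p Hp).
        assert (E : (fst p - a) ^ 2 + (snd p - b) ^ 2 = r ^ 2).
        { rewrite <- Heq, Cmod2_alt. unfold a, b. destruct p, z. simpl. ring. }
        assert (q p <= - M); [|lra].
        assert (Hx : fst p - a <= r) by (pose proof (pow2_ge_0 (snd p - b)); nra).
        unfold q. replace (- (M / r ^ 2) * (snd p - b) ^ 2) with
          (- (M / r ^ 2) * (r ^ 2 - (fst p - a) ^ 2)) by (rewrite <- E; ring).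
        replace (M / r ^ 2 * (fst p - a) ^ 2 + - (M / r ^ 2) * (r ^ 2 - (fst p - a) ^ 2) +
           - (2 * M / r) * (fst p - a) + 0) with
          (- M - 2 * (M / r ^ 2) * ((fst p - a) * (r - (fst p - a)))) by (field; lra).
        assert (0 <= M / r ^ 2). { apply Rmult_le_pos; [lra|]. left. apply Rinv_0_lt_compat. nra. }
        assert (0 <= (fst p - a) * (r - (fst p - a))) by (apply Rmult_le_pos; lra).
        nra. }
  apply (derive_le_of_right_slope
    (fun t => 1 / 2 * u (a + t, b) + - (1 / 2) * u (a - t, b)) l (2 * M / r) r Hr).
  - replace l with (1 / 2 * l + - (1 / 2) * - l) by field.
    assert (D1 : is_derive (fun t => u (a + t, b)) 0 l).
    { replace l with (scal 1 l) by (unfold scal; simpl; unfold mult; simpl; ring).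
      apply (is_derive_comp (fun x => u (x, b)) (fun t => a + t)).
      - rewrite Rplus_0_r. exact Hl.
      - auto_derive; trivial. }
    assert (D2 : is_derive (fun t => u (a - t, b)) 0 (- l)).
    { replace (- l) with (scal (-1) l) by (unfold scal; simpl; unfold mult; simpl; ring).
      apply (is_derive_comp (fun x => u (x, b)) (fun t => a - t)).
      - rewrite Rminus_0_r. exact Hl.
      - auto_derive; trivial; ring. }
    apply (is_derive_plus (fun t => 1 / 2 * u (a + t, b)) (fun t => - (1 / 2) * u (a - t, b))).
    + apply is_derive_scal. exact D1.
    + apply is_derive_scal. exact D2.
  - intros t Ht. rewrite Rplus_0_r, Rminus_0_r.
    assert (Hs : S (a + t, b)).
    { split; [|simpl; lra]. apply Cmod_le_sq; [lra|]. unfold a, b. destruct z. simpl. nra. }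
    specialize (Hcmp _ Hs). unfold w, q, reflect_x in Hcmp. simpl in Hcmp.
    replace (2 * a - (a + t)) with (a - t) in Hcmp by ring.
    replace (a + t - a) with t in Hcmp by ring. replace (b - b) with 0 in Hcmp by ring.
    assert (0 <= M / (r * (r * 1)) * (t * (t * 1))).
    { apply Rmult_le_pos; [|nra]. apply Rmult_le_pos; [lra|]. left. apply Rinv_0_lt_compat. nra. }
    lra.
Qed.

Lemma harmonic_partial_x_bound (u : C -> R) (z : C) (r M c l : R)
  (Hr : 0 < r)
  (Hcont : forall p, Cmod (p - z) <= r -> continuous u p)
  (Hlap : forall p, Cmod (p - z) <= r -> laplacian u p 0)
  (HM : forall p, Cmod (p - z) <= r -> Rabs (u p - c) <= M)
  (Hl : is_derive (fun x => u (x, snd z)) (fst z) l) :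
  Rabs l <= 2 * M / r.
Proof.
  apply Rabs_le. split.
  - apply Ropp_le_cancel. rewrite Ropp_involutive.
    apply (harmonic_partial_x_upper (fun p => -1 * u p) z r M (- c)); trivial.
    + intros p Hp. apply continuous_multR; [apply continuous_const|auto].
    + intros p Hp. replace 0 with (-1 * 0) by ring. apply laplacian_scal. auto.
    + intros p Hp. replace (-1 * u p - - c) with (- (u p - c)) by ring. rewrite Rabs_Ropp. auto.
    + replace (- l) with (-1 * l) by ring. apply is_derive_scal. exact Hl.
  - apply (harmonic_partial_x_upper u z r M c); trivial.
Qed.

Definition swap (p : C) : C := (snd p, fst p).

Lemma locally_swap (p : C) (P : C -> Prop) :
  locally (swap p) P -> locally p (fun q => P (swap q)).
Proof.
  intros [e He]. exists e. intros q [H1 H2]. apply He. split; assumption.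
Qed.

Lemma laplacian_swap (u : C -> R) (p : C) (l : R) :
  laplacian u (swap p) l -> laplacian (fun q => u (swap q)) p l.
Proof.
  intros (wx & wy & lx & ly & Hloc & Hx & Hy & Hl).
  exists (fun q => wy (swap q)), (fun q => wx (swap q)), ly, lx.
  split; [|split; [exact Hy|split; [exact Hx|lra]]].
  apply locally_swap in Hloc. revert Hloc. apply filter_imp. intros q [H1 H2]. split; assumption.
Qed.

Lemma harmonic_gradient_bound (u : C -> R) (z : C) (r M c lx ly : R)
  (Hr : 0 < r)
  (Hcont : forall p, Cmod (p - z) <= r -> continuous u p)
  (Hlap : forall p, Cmod (p - z) <= r -> laplacian u p 0)
  (HM : forall p, Cmod (p - z) <= r -> Rabs (u p - c) <= M)
  (Hx : is_derive (fun x => u (x, snd z)) (fst z) lx)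
  (Hy : is_derive (fun y => u (fst z, y)) (snd z) ly) :
  Rabs lx <= 2 * M / r /\ Rabs ly <= 2 * M / r.
Proof.
  split; [exact (harmonic_partial_x_bound u z r M c lx Hr Hcont Hlap HM Hx)|].
  assert (Hsw : forall p, Cmod (p - swap z) <= r -> Cmod (swap p - z) <= r).
  { intros p. rewrite !Cmod_le_sq by lra. destruct p, z. simpl. lra. }
  apply (harmonic_partial_x_bound (fun p => u (swap p)) (swap z) r M c ly Hr).
  - intros p Hp. apply (filterlim_comp _ _ _ swap u _ (locally (swap p))).
    + intros P HP. apply locally_swap. exact HP.
    + apply Hcont, Hsw, Hp.
  - intros p Hp. apply laplacian_swap. apply Hlap, Hsw, Hp.
  - intros p Hp. apply HM, Hsw, Hp.
  - exact Hy.
Qed.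

Lemma nearest_boundary_point (z : C) : disk z ->
  exists zeta, Cmod zeta = 1 /\ Cmod (z - zeta) = 1 - Cmod z.
Proof.
  intros Hz. unfold disk in Hz. destruct (classic (z = RtoC 0)) as [->|Hn].
  - exists (RtoC 1). split; [apply Cmod_1|]. replace (0 - 1)%C with (- (1))%C by ring.
    rewrite Cmod_opp, Cmod_1, Cmod_0. ring.
  - pose proof (proj1 (Cmod_gt_0 z) Hn) as Hp.
    assert (Hm : RtoC (Cmod z) <> 0) by (intros E; apply RtoC_inj in E; lra).
    exists (z / Cmod z)%C. split.
    + rewrite Cmod_div, Cmod_R, Rabs_right by (trivial; lra). field. lra.
    + replace (z - z / Cmod z)%C with (z * (RtoC (1 - / Cmod z)))%C.
      2: { rewrite RtoC_minus, RtoC_inv by lra. field. exact Hm. }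
      rewrite Cmod_mult, Cmod_R, Rabs_left.
      * field. lra.
      * assert (1 < / Cmod z); [|lra]. rewrite <- Rinv_1. apply Rinv_lt_contravar; lra.
Qed.

(** At distance [d] from the circle, [boundary_holder_upper] at the nearest boundary point bounds
    the oscillation of [U] on the disk of radius [d / 2] by a multiple of [d ^ alpha]; the
    gradient estimate divides this by [d]. *)
Lemma gradient_growth (alpha A : R) (U : C -> R)
  (Halpha : 0 < alpha < 1) (HA : 0 <= A)
  (HU : continuous_on closed_disk U)
  (Hlap : forall p, disk p -> laplacian U p 0)
  (Hb : forall p zeta, Cmod p = 1 -> Cmod zeta = 1 ->
     Rabs (U p - U zeta) <= A * hpow (Cmod (p - zeta)) alpha) :
  exists B, 0 <= B /\ forall z lx ly, disk z ->
    is_derive (fun x => U (x, snd z)) (fst z) lx ->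
    is_derive (fun y => U (fst z, y)) (snd z) ly ->
    Rabs lx <= B * Rpower (1 - Cmod z) (alpha - 1) /\
    Rabs ly <= B * Rpower (1 - Cmod z) (alpha - 1).
Proof.
  set (A' := A * barrier_constant alpha).
  assert (HA' : 0 <= A').
  { apply Rmult_le_pos; [lra|]. apply Rmult_le_pos; [left; apply exp_pos|].
    left. apply Rinv_0_lt_compat. apply cos_half_pos. exact Halpha. }
  exists (4 * A' * Rpower 2 alpha). split.
  { apply Rmult_le_pos; [lra|]. left. apply exp_pos. }
  intros z lx ly Hz Hx Hy.
  destruct (nearest_boundary_point z Hz) as (zeta & Hzeta & Hd).
  set (d := 1 - Cmod z) in *. assert (Hd0 : 0 < d) by (unfold d, disk in *; lra).
  assert (Hin : forall p, Cmod (p - z) <= d / 2 -> disk p).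
  { intros p Hp. pose proof (Cmod_triangle (p - z) z) as Ht.
    replace (p - z + z)%C with p in Ht by ring. unfold disk, d in *. lra. }
  assert (Hosc : forall p, Cmod (p - z) <= d / 2 ->
     Rabs (U p - U zeta) <= A' * hpow (2 * d) alpha).
  { intros p Hp.
    assert (Hpz : 0 <= Cmod (p - zeta) <= 2 * d).
    { split; [apply Cmod_ge_0|]. pose proof (Cmod_triangle (p - z) (z - zeta)) as Ht.
      replace (p - z + (z - zeta))%C with (p - zeta)%C in Ht by ring. lra. }
    apply Rle_trans with (A' * hpow (Cmod (p - zeta)) alpha).
    2: { apply Rmult_le_compat_l; [lra|]. apply hpow_le; lra. }
    specialize (Hin p Hp). apply Rabs_le. split.
    - pose proof (boundary_holder_upper alpha A (fun p => -1 * U p) zeta p Halpha HA) as H.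
      fold A' in H. cbv beta in H.
      assert (-1 * U p - -1 * U zeta <= A' * hpow (Cmod (p - zeta)) alpha); [|lra].
      apply H; trivial.
      + intros x Hx'. apply (filterlim_comp _ _ _ U (fun y => -1 * y) _ (locally (U x))).
        * apply HU. exact Hx'.
        * apply (filterlim_scal_r (-1) (U x)).
      + intros x Hx'. replace 0 with (-1 * 0) by ring. apply laplacian_scal. auto.
      + intros x Hx'. specialize (Hb x zeta Hx' Hzeta). apply Rabs_le_between in Hb. lra.
    - apply boundary_holder_upper; trivial.
      intros x Hx'. specialize (Hb x zeta Hx' Hzeta). apply Rabs_le_between in Hb. lra. }
  pose proof (harmonic_gradient_bound U z (d / 2) (A' * hpow (2 * d) alpha) (U zeta) lx ly
    ltac:(lra)) as Hg.
  replace (4 * A' * Rpower 2 alpha * Rpower d (alpha - 1)) with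
    (2 * (A' * hpow (2 * d) alpha) / (d / 2)).
  2: { rewrite hpow_pos by lra. rewrite <- Rpower_mult_distr by lra.
       replace (Rpower d (alpha - 1)) with (Rpower d alpha * / d).
       - field. lra.
       - unfold Rminus. rewrite Rpower_plus, Rpower_Ropp, Rpower_1 by lra. reflexivity. }
  apply Hg; trivial.
  - intros p Hp. apply (continuous_continuous_on closed_disk); [|exact HU].
    generalize (locally_disk p (Hin p Hp)). apply filter_imp. apply disk_closed_disk.
  - intros p Hp. apply Hlap. apply Hin. exact Hp.
Qed.

(** * The identity theorem *)

(** Twice differentiable in the sense of [cr_derive]: just enough for the real part to be
    harmonic, and stable under products. *)
Definition holomorphic2 (f : C -> C) (z : C) : Prop :=
  exists (f' : C -> C) (l : C),
    locally z (fun p => cr_derive f p (f' p)) /\ cr_derive f' z l.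

Lemma holomorphic2_const (c z : C) : holomorphic2 (fun _ => c) z.
Proof.
  exists (fun _ => RtoC 0), (RtoC 0). split; [apply filter_forall; intros|]; apply cr_derive_const.
Qed.

Lemma holomorphic2_mult (f g : C -> C) (z : C) :
  holomorphic2 f z -> holomorphic2 g z -> holomorphic2 (fun p => f p * g p)%C z.
Proof.
  intros (f' & l & Hf & Hl) (g' & m & Hg & Hm).
  exists (fun p => f' p * g p + f p * g' p)%C.
  exists ((l * g z + f' z * g' z) + (f' z * g' z + f z * m))%C. split.
  - generalize (filter_and _ _ Hf Hg). apply filter_imp. intros p [H1 H2].
    apply cr_derive_mult; assumption.
  - apply locally_singleton in Hf, Hg.
    apply (cr_derive_plus (fun p => f' p * g p)%C (fun p => f p * g' p)%C);
      apply cr_derive_mult; assumption.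
Qed.

Lemma holomorphic2_pow (f : C -> C) (z : C) (n : nat) :
  holomorphic2 f z -> holomorphic2 (fun p => f p ^ n)%C z.
Proof.
  intros Hf. induction n as [|n IH].
  - exact (holomorphic2_const 1 z).
  - exact (holomorphic2_mult f (fun p => f p ^ n)%C z Hf IH).
Qed.

Lemma laplacian_Re_holomorphic2 (f : C -> C) (z : C) :
  holomorphic2 f z -> laplacian (fun p => Re (f p)) z 0.
Proof. intros (f' & l & H1 & H2). exact (laplacian_Re_cr f f' z l H1 H2). Qed.

Lemma cr_derive_affine (m b z : C) : cr_derive (fun p => m * p + b)%C z m.
Proof. destruct m, b. split; split; simpl; auto_derive; trivial; ring. Qed.

Lemma holomorphic2_affine (m b z : C) : holomorphic2 (fun p => m * p + b)%C z.
Proof.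
  exists (fun _ => m), (RtoC 0). split; [|apply cr_derive_const].
  apply filter_forall. intros p. apply cr_derive_affine.
Qed.

Lemma holomorphic2_inv_affine (m b z : C) :
  locally z (fun p => (m * p + b)%C <> 0) -> holomorphic2 (fun p => / (m * p + b))%C z.
Proof.
  intros Hn. set (f := fun p => (m * p + b)%C).
  assert (D : forall p, f p <> 0 -> cr_derive (fun p => / f p)%C p (- m / (f p * f p))%C).
  { intros p Hp. apply cr_derive_inv; [apply cr_derive_affine|exact Hp]. }
  exists (fun p => - m * (/ f p * / f p))%C.
  pose proof (locally_singleton _ _ Hn) as H0. fold (f z) in H0.
  eexists. split.
  - revert Hn. apply filter_imp. intros p Hp. fold (f p) in Hp.
    apply cr_derive_eq with (1 := D p Hp). field. exact Hp.
  - apply (cr_derive_mult (fun _ => - m)%C (fun p => / f p * / f p)%C); [apply cr_derive_const|].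
    apply (cr_derive_mult (fun p => / f p)%C (fun p => / f p)%C); apply D; exact H0.
Qed.

Definition continuousC (f : C -> C) (z : C) : Prop :=
  continuous (fun p => Re (f p)) z /\ continuous (fun p => Im (f p)) z.

Lemma continuousC_const (c z : C) : continuousC (fun _ => c) z.
Proof. split; apply continuous_const. Qed.

Lemma continuousC_plus (f g : C -> C) (z : C) :
  continuousC f z -> continuousC g z -> continuousC (fun p => f p + g p)%C z.
Proof. intros [F1 F2] [G1 G2]. split; apply continuous_plusR; assumption. Qed.

Lemma continuousC_mult (f g : C -> C) (z : C) :
  continuousC f z -> continuousC g z -> continuousC (fun p => f p * g p)%C z.
Proof.
  intros [F1 F2] [G1 G2]. split.
  - apply (continuous_minus (fun p => Re (f p) * Re (g p)) (fun p => Im (f p) * Im (g p)));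
      apply continuous_multR; assumption.
  - apply (continuous_plusR (fun p => Re (f p) * Im (g p)) (fun p => Im (f p) * Re (g p)));
      apply continuous_multR; assumption.
Qed.

Lemma continuousC_id (z : C) : continuousC (fun p => p) z.
Proof. apply continuous_coord. Qed.

Lemma continuousR_ext (f g : C -> R) (z : C) :
  (forall p, f p = g p) -> continuous f z -> continuous g z.
Proof. exact (continuous_ext f g z). Qed.

Lemma continuous_Cmod2 (f : C -> C) (z : C) :
  continuousC f z -> continuous (fun p => Cmod (f p) ^ 2) z.
Proof.
  intros [F1 F2].
  apply (continuousR_ext (fun p => Re (f p) * Re (f p) + Im (f p) * Im (f p))).
  - intros p. rewrite Cmod2_alt. ring.
  - apply continuous_plusR; apply continuous_multR; assumption.
Qed.

Lemma continuousC_inv (f : C -> C) (z : C) :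
  continuousC f z -> f z <> 0 -> continuousC (fun p => / f p)%C z.
Proof.
  intros Hf Hn. pose proof (continuous_Cmod2 f z Hf) as H2. destruct Hf as [F1 F2].
  assert (HN : continuous (fun p => / Cmod (f p) ^ 2) z).
  { apply (continuous_comp_derivable _ Rinv z H2). apply Cmod_gt_0 in Hn. auto_derive. nra. }
  split.
  - apply (continuousR_ext (fun p => Re (f p) * / Cmod (f p) ^ 2)).
    + intros p. rewrite Cmod2_alt. reflexivity.
    + apply continuous_multR; assumption.
  - apply (continuousR_ext (fun p => - Im (f p) * / Cmod (f p) ^ 2)).
    + intros p. rewrite Cmod2_alt. reflexivity.
    + apply continuous_multR; [apply (continuous_opp (fun p => Im (f p)))|]; assumption.
Qed.

Lemma continuousC_pow (f : C -> C) (z : C) (n : nat) :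
  continuousC f z -> continuousC (fun p => f p ^ n)%C z.
Proof.
  intros Hf. induction n as [|n IH].
  - exact (continuousC_const 1 z).
  - exact (continuousC_mult f (fun p => f p ^ n)%C z Hf IH).
Qed.

(** The reciprocal of the Blaschke factor of the disk [|p| < rho] that vanishes at [a]: it has
    modulus [1] on the circle and more inside. *)
Definition inverse_blaschke (rho : R) (a p : C) : C :=
  ((- Cconj a * p + RtoC (rho ^ 2)) * / (RtoC rho * p + - (RtoC rho * a)))%C.

Lemma blaschke_identity (rho : R) (a p : C) :
  Cmod (- Cconj a * p + RtoC (rho ^ 2)) ^ 2 =
  Cmod (RtoC rho * p + - (RtoC rho * a)) ^ 2 +
  (rho ^ 2 - Cmod a ^ 2) * (rho ^ 2 - Cmod p ^ 2).
Proof. rewrite !Cmod2_alt. destruct a, p. simpl. ring. Qed.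

Lemma Cmod_shift (rho : R) (a p : C) : 0 < rho ->
  Cmod (RtoC rho * p + - (RtoC rho * a)) = rho * Cmod (p - a).
Proof.
  intros H. replace (RtoC rho * p + - (RtoC rho * a))%C with (RtoC rho * (p - a))%C by ring.
  rewrite Cmod_mult, Cmod_R, Rabs_right by lra. reflexivity.
Qed.

Lemma inverse_blaschke_boundary (rho : R) (a p : C) :
  0 < rho -> 0 < Cmod (p - a) -> Cmod p = rho -> Cmod (inverse_blaschke rho a p) = 1.
Proof.
  intros Hr Hp E. unfold inverse_blaschke.
  assert (Hd : 0 < Cmod (RtoC rho * p + - (RtoC rho * a))).
  { rewrite Cmod_shift by lra. apply Rmult_lt_0_compat; lra. }
  rewrite Cmod_mult, Cmod_inv by (apply Cmod_gt_0; exact Hd).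
  pose proof (blaschke_identity rho a p) as H. rewrite E in H.
  replace (Cmod (- Cconj a * p + RtoC (rho ^ 2))) with (Cmod (RtoC rho * p + - (RtoC rho * a))).
  - field. lra.
  - apply Rsqr_inj; try apply Cmod_ge_0. unfold Rsqr. nra.
Qed.

Lemma inverse_blaschke_inside (rho : R) (a p : C) :
  0 < rho -> 0 < Cmod (p - a) -> Cmod a < rho -> Cmod p < rho -> 1 < Cmod (inverse_blaschke rho a p).
Proof.
  intros Hr Hp Ha Hp'. unfold inverse_blaschke.
  assert (Hd : 0 < Cmod (RtoC rho * p + - (RtoC rho * a))).
  { rewrite Cmod_shift by lra. apply Rmult_lt_0_compat; lra. }
  rewrite Cmod_mult, Cmod_inv by (apply Cmod_gt_0; exact Hd).
  pose proof (blaschke_identity rho a p) as H.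
  pose proof (Cmod_ge_0 a). pose proof (Cmod_ge_0 p).
  apply (Rmult_lt_reg_r (Cmod (RtoC rho * p + - (RtoC rho * a)))); [exact Hd|].
  rewrite Rmult_assoc, Rinv_l, Rmult_1_l, Rmult_1_r by lra.
  apply Rsqr_incrst_0; try apply Cmod_ge_0. unfold Rsqr.
  assert (0 < (rho ^ 2 - Cmod a ^ 2) * (rho ^ 2 - Cmod p ^ 2)).
  { apply Rmult_lt_0_compat; nra. }
  nra.
Qed.

(** As [H] vanishes near [a], it can be divided by any power of a Blaschke factor with zero at
    [a]. This does not change its modulus on the circle of radius [rho], so the maximum
    principle bounds [|H z0| |Q z0|^n] by the maximum of [|H|] for all [n], where [Q] is the
    reciprocal of that factor. Since [|Q z0| > 1], [H z0 = 0]. One factor serves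
    every [z0] in the disk of radius [rho], so the vanishing spreads in a single step. *)
Lemma identity_theorem (H : C -> C) (a : C) (r : R)
  (Hhol : forall z, disk z -> holomorphic2 H z)
  (Hcont : forall z, disk z -> continuousC H z)
  (Ha : disk a) (Hr : 0 < r)
  (Hzero : forall p, Cmod (p - a) < r -> H p = 0) :
  forall z, disk z -> H z = 0.
Proof.
  intros z0 Hz0. apply NNPP. intros Hne. unfold disk in *.
  set (rho := (Rmax (Cmod z0) (Cmod a) + 1) / 2).
  pose proof (Rmax_l (Cmod z0) (Cmod a)). pose proof (Rmax_r (Cmod z0) (Cmod a)).
  assert (Rmax (Cmod z0) (Cmod a) < 1) by (apply Rmax_lub_lt; assumption).
  pose proof (Cmod_ge_0 a).
  assert (Hrho : 0 < rho < 1) by (unfold rho; lra).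
  assert (Hz0r : Cmod z0 < rho) by (unfold rho; lra).
  assert (Har : Cmod a < rho) by (unfold rho; lra).
  assert (Hfar : r <= Cmod (z0 - a)).
  { apply Rnot_lt_le. intros Hlt. exact (Hne (Hzero z0 Hlt)). }
  set (Q := inverse_blaschke rho a).
  assert (Hclosed : forall p, ~ Cmod p <= rho -> locally p (fun q => ~ Cmod q <= rho)).
  { intros p Hp. apply Rnot_le_lt in Hp. rewrite <- (Cminus_0_r p) in Hp.
    generalize (locally_Cmod_gt p 0 rho Hp). apply filter_imp. intros q.
    rewrite Cminus_0_r. lra. }
  destruct (bounded_on_compact (fun p => Cmod p <= rho) rho (fun p => Cmod (H p) ^ 2)) as [M0 HM0].
  { trivial. }
  { exact Hclosed. }
  { intros p Hp. apply (filterlim_filter_le_1 (F := locally p) _ (filter_le_within _)).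
    apply continuous_Cmod2. apply Hcont. lra. }
  set (M := 1 + M0).
  assert (HM : forall p, Cmod p <= rho -> Cmod (H p) <= M).
  { intros p Hp. specialize (HM0 p Hp). simpl in HM0. unfold M. pose proof (Cmod_ge_0 (H p)). nra. }
  assert (Hden : forall p, 0 < Cmod (p - a) -> (RtoC rho * p + - (RtoC rho * a))%C <> 0).
  { intros p Hp. apply Cmod_gt_0. rewrite Cmod_shift by lra. apply Rmult_lt_0_compat; lra. }
  assert (Hbound : forall n c, Re (c * (H z0 * Q z0 ^ n)) <= Cmod c * M).
  { intros n c.
    (* The pole of [Q] is cut out; [H] vanishes on the collar [r / 2 <= |p - a| < r]. *)
    assert (Hs : forall p, Cmod p <= rho /\ r / 2 <= Cmod (p - a) ->
      Re (c * (H p * Q p ^ n)) + - (Cmod c * M) <= 0).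
    { apply (maximum_principle _ rho).
      - tauto.
      - intros p Hp. destruct (Rle_lt_dec (Cmod p) rho) as [H1'|H1'].
        + assert (H2' : Cmod (p - a) < r / 2) by (apply Rnot_le_lt; tauto).
          generalize (locally_Cmod_lt p a (r / 2) H2'). apply filter_imp. intros q Hq1 [_ Hq2]. lra.
        + generalize (Hclosed p ltac:(lra)). apply filter_imp. tauto.
      - intros p [Hp1 Hp2].
        apply (filterlim_filter_le_1 (F := locally p) _ (filter_le_within _)).
        cut (continuousC (fun p => c * (H p * Q p ^ n))%C p).
        { intros [Hre _]. exact (continuous_plusR _ (fun _ => - (Cmod c * M)) p Hre
            (continuous_const _ _)). }
        apply (continuousC_mult (fun _ => c) (fun p => H p * Q p ^ n)%C); [apply continuousC_const|].
        apply continuousC_mult; [apply Hcont; lra|]. apply continuousC_pow.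
        apply continuousC_mult.
        + apply continuousC_plus; [|apply continuousC_const].
          apply continuousC_mult; [apply continuousC_const|apply continuousC_id].
        + apply (continuousC_inv (fun p => RtoC rho * p + - (RtoC rho * a))%C).
          * apply continuousC_plus; [|apply continuousC_const].
            apply continuousC_mult; [apply continuousC_const|apply continuousC_id].
          * apply Hden. lra.
      - intros p [Hp1 Hp2].
        destruct (Rle_lt_or_eq_dec _ _ Hp1) as [Hlt|Heq].
        + destruct (Rlt_le_dec (Cmod (p - a)) r) as [Hin|Hout].
          * left. rewrite (Hzero p Hin).
            replace (c * (0 * Q p ^ n))%C with (RtoC 0) by ring. simpl.
            pose proof (Cmod_ge_0 c). pose proof (Cmod_ge_0 (H a)).
            pose proof (HM a ltac:(lra)). nra.
          * right. assert (Hgt : r / 2 < Cmod (p - a)) by lra.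
            pose proof (locally_Cmod_gt p a (r / 2) Hgt) as L1.
            split.
            -- rewrite <- (Cminus_0_r p) in Hlt.
               generalize (filter_and _ _ (locally_Cmod_lt p 0 rho Hlt) L1). apply filter_imp.
               intros q. rewrite Cminus_0_r. lra.
            -- exists (0 + 0). split; [lra|].
               apply (laplacian_plus (fun p => Re (c * (H p * Q p ^ n)))); [|apply laplacian_const].
               apply laplacian_Re_holomorphic2.
               apply (holomorphic2_mult (fun _ => c) (fun p => H p * Q p ^ n)%C);
                 [apply holomorphic2_const|].
               apply holomorphic2_mult; [apply Hhol; lra|].
               apply holomorphic2_pow. apply holomorphic2_mult; [apply holomorphic2_affine|].
               apply holomorphic2_inv_affine. revert L1. apply filter_imp.
               intros q Hq. apply Hden. lra.
        + left. pose proof (re_le_Cmod (c * (H p * Q p ^ n))) as Hre.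
          rewrite !Cmod_mult, Cmod_pow in Hre. unfold Q in Hre.
          rewrite inverse_blaschke_boundary, pow1, Rmult_1_r in Hre by lra.
          fold Q in Hre. pose proof (Rle_abs (Re (c * (H p * Q p ^ n)))).
          pose proof (HM p Hp1). pose proof (Cmod_ge_0 c). nra. }
    specialize (Hs z0). lra. }
  assert (Hpos : 0 < Cmod (H z0)) by (apply Cmod_gt_0; exact Hne).
  assert (Hq : 1 < Cmod (Q z0)) by (apply inverse_blaschke_inside; lra).
  assert (Hall : forall n, Cmod (H z0) * Cmod (Q z0) ^ n <= M).
  { intros n. set (w := (H z0 * Q z0 ^ n)%C).
    (* This constant rotates [w] onto the positive axis, so its real part is its modulus. *)
    pose proof (Hbound n (Cconj w)) as Hb. fold w in Hb. rewrite Cmod_conj in Hb.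
    replace (Re (Cconj w * w)) with (Cmod w ^ 2) in Hb.
    2: { rewrite Cmod2_alt. destruct w. simpl. ring. }
    assert (E : Cmod w = Cmod (H z0) * Cmod (Q z0) ^ n).
    { unfold w. rewrite Cmod_mult, Cmod_pow. reflexivity. }
    rewrite <- E. assert (0 < Cmod w); [|nra].
    rewrite E. apply Rmult_lt_0_compat; [exact Hpos|]. apply pow_lt. lra. }
  destruct (Pow_x_infinity (Cmod (Q z0))) with (b := (M + 1) / Cmod (H z0)) as [N HN].
  { rewrite Rabs_right; lra. }
  specialize (HN N ltac:(lia)). specialize (Hall N).
  rewrite Rabs_right in HN by (apply Rle_ge, pow_le; lra).
  apply Rge_le in HN. apply (Rmult_le_compat_l (Cmod (H z0))) in HN; [|lra].
  replace (Cmod (H z0) * ((M + 1) / Cmod (H z0))) with (M + 1) in HN by (field; lra).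
  lra.
Qed.

(** * Complex derivatives and the dilatation *)

Lemma im_le_Cmod (z : C) : Rabs (Im z) <= Cmod z.
Proof. exact (Rle_trans _ _ _ (Rmax_r _ _) (Rmax_Cmod z)). Qed.

Lemma Cmod_le_parts (z : C) : Cmod z <= Rabs (Re z) + Rabs (Im z).
Proof.
  replace z with (RtoC (Re z) + RtoC (Im z) * Ci)%C at 1.
  - apply Rle_trans with (1 := Cmod_triangle _ _).
    rewrite Cmod_mult, Cmod_Ci, !Cmod_R. lra.
  - destruct z. unfold Cplus, Cmult, Ci, RtoC. simpl. f_equal; ring.
Qed.

Lemma complex_derive_eps (f : C -> C) (z l : C) :
  @is_derive C_AbsRing C_NormedModule f z l ->
  forall eps : posreal, exists d : posreal, forall p, Cmod (p - z) < d ->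
    Cmod (f p - f z - (p - z) * l) <= eps * Cmod (p - z).
Proof.
  intros [_ H] eps. destruct (H z (fun P HP => HP) eps) as [d Hd].
  exists d. intros p Hp. exact (Hd p Hp).
Qed.

Lemma complex_derive_line (f : C -> C) (p q l : C) (t : R) :
  @is_derive C_AbsRing C_NormedModule f (p + RtoC t * q)%C l ->
  is_derive (fun s : R => Re (f (p + RtoC s * q)%C)) t (Re (q * l)) /\
  is_derive (fun s : R => Im (f (p + RtoC s * q)%C)) t (Im (q * l)).
Proof.
  intros H.
  assert (K : forall eps, 0 < eps -> exists d : posreal, forall h, h <> 0 -> Rabs h < d ->
    Cmod ((f (p + RtoC (t + h) * q)%C - f (p + RtoC t * q)%C) / RtoC h - q * l) < eps).
  { intros eps Heps.
    assert (Hq1 : 0 < Cmod q + 1) by (pose proof (Cmod_ge_0 q); lra).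
    assert (He : 0 < eps / (Cmod q + 1)) by (apply Rdiv_lt_0_compat; lra).
    destruct (complex_derive_eps f _ l H (mkposreal _ He)) as [d Hd]. simpl in Hd.
    assert (Hd' : 0 < d / (Cmod q + 1)) by (apply Rdiv_lt_0_compat; [apply cond_pos|lra]).
    exists (mkposreal _ Hd'). simpl. intros h Hh0 Hh.
    assert (Hhc : RtoC h <> 0) by (intros E; apply RtoC_inj in E; lra).
    assert (E : (p + RtoC (t + h) * q - (p + RtoC t * q))%C = (RtoC h * q)%C).
    { rewrite RtoC_plus. ring. }
    specialize (Hd (p + RtoC (t + h) * q)%C). rewrite E in Hd.
    rewrite Cmod_mult, Cmod_R in Hd.
    assert (Hah : 0 < Rabs h) by (apply Rabs_pos_lt; exact Hh0).
    pose proof (Cmod_ge_0 q).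
    assert (Hlt : Rabs h * Cmod q < d).
    { apply Rmult_lt_compat_r with (r := Cmod q + 1) in Hh; [|lra].
      replace (d / (Cmod q + 1) * (Cmod q + 1)) with (pos d) in Hh by (field; lra). nra. }
    specialize (Hd Hlt).
    replace ((f (p + RtoC (t + h) * q)%C - f (p + RtoC t * q)%C) / RtoC h - q * l)%C with
      ((f (p + RtoC (t + h) * q)%C - f (p + RtoC t * q)%C - RtoC h * q * l) / RtoC h)%C
      by (field; exact Hhc).
    rewrite Cmod_div, Cmod_R by exact Hhc.
    apply Rlt_div_l; [lra|]. apply Rle_lt_trans with (1 := Hd).
    apply Rlt_le_trans with (eps / (Cmod q + 1) * (Rabs h * (Cmod q + 1))).
    - apply Rmult_lt_compat_l; [exact He|]. nra.
    - right. field. lra. }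
  split; apply is_derive_Reals; intros eps Heps; destruct (K eps Heps) as [d Hd];
    exists d; intros h Hh0 Hh; specialize (Hd h Hh0 Hh);
    apply Rle_lt_trans with (2 := Hd).
  - apply Rle_trans with (2 := re_le_Cmod _). right. f_equal.
    set (A := f (p + RtoC (t + h) * q)%C). set (B := f (p + RtoC t * q)%C).
    destruct A, B, q, l. simpl. field. exact Hh0.
  - apply Rle_trans with (2 := im_le_Cmod _). right. f_equal.
    set (A := f (p + RtoC (t + h) * q)%C). set (B := f (p + RtoC t * q)%C).
    destruct A, B, q, l. simpl. field. exact Hh0.
Qed.

Lemma complex_derive_cr (f : C -> C) (z l : C) :
  @is_derive C_AbsRing C_NormedModule f z l -> cr_derive f z l.
Proof.
  intros H. destruct z as [x y].
  assert (Ex : forall s, ((0, y) + RtoC s * RtoC 1)%C = (s, y)).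
  { intros. unfold Cplus, Cmult. simpl. f_equal; ring. }
  assert (Ey : forall s, ((x, 0) + RtoC s * Ci)%C = (x, s)).
  { intros. unfold Cplus, Cmult. simpl. f_equal; ring. }
  pose proof (complex_derive_line f (0, y) (RtoC 1) l x) as Hx. rewrite Ex in Hx.
  pose proof (complex_derive_line f (x, 0) Ci l y) as Hy. rewrite Ey in Hy.
  destruct (Hx H) as [X1 X2]. destruct (Hy H) as [Y1 Y2]. clear Hx Hy.
  split; split; simpl.
  - apply is_derive_eq with (Re (1 * l)); [|destruct l; simpl; ring].
    eapply is_derive_ext; [|exact X1]. intros s. cbv beta. rewrite Ex. reflexivity.
  - apply is_derive_eq with (Im (1 * l)); [|destruct l; simpl; ring].
    eapply is_derive_ext; [|exact X2]. intros s. cbv beta. rewrite Ex. reflexivity.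
  - apply is_derive_eq with (Re (Ci * l)); [|destruct l; simpl; ring].
    eapply is_derive_ext; [|exact Y1]. intros s. cbv beta. rewrite Ey. reflexivity.
  - apply is_derive_eq with (Im (Ci * l)); [|destruct l; simpl; ring].
    eapply is_derive_ext; [|exact Y2]. intros s. cbv beta. rewrite Ey. reflexivity.
Qed.

Lemma complex_derive_continuousC (f : C -> C) (z l : C) :
  @is_derive C_AbsRing C_NormedModule f z l -> continuousC f z.
Proof.
  intros H.
  assert (K : forall eps : posreal, locally z (fun p => Cmod (f p - f z) < eps)).
  { intros eps. destruct (complex_derive_eps f z l H (mkposreal 1 Rlt_0_1)) as [d Hd].
    simpl in Hd. pose proof (Cmod_ge_0 l).
    assert (He : 0 < eps / (2 + Cmod l)) by (apply Rdiv_lt_0_compat; [apply cond_pos|lra]).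
    generalize (filter_and _ _ (locally_C_lt z d) (locally_C_lt z (mkposreal _ He))).
    apply filter_imp. simpl. intros p [H1 H2]. specialize (Hd p H1).
    pose proof (Cmod_triangle (f p - f z - (p - z) * l) ((p - z) * l)) as Ht.
    replace (f p - f z - (p - z) * l + (p - z) * l)%C with (f p - f z)%C in Ht by ring.
    rewrite Cmod_mult in Ht.
    apply Rmult_lt_compat_r with (r := 2 + Cmod l) in H2; [|lra].
    replace (eps / (2 + Cmod l) * (2 + Cmod l)) with (pos eps) in H2 by (field; lra).
    pose proof (Cmod_ge_0 (p - z)). pose proof (cond_pos eps).
    destruct (Req_dec (Cmod (p - z)) 0) as [E|E]; [rewrite E in *; lra|nra]. }
  split; apply filterlim_locally; intros eps; generalize (K eps); apply filter_imp; intros p Hp;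
    apply Rle_lt_trans with (2 := Hp).
  - exact (re_le_Cmod (f p - f z)%C).
  - exact (im_le_Cmod (f p - f z)%C).
Qed.

Lemma cr_derive_partials (w : C -> R) (Phi : C -> C) (z l : C) :
  locally z (fun p => w p = Re (Phi p)) -> cr_derive Phi z l ->
  partial_x w z = Re l /\ partial_y w z = - Im l.
Proof.
  intros Hloc [[F1 _] [F3 _]]. split; apply is_derive_unique.
  - eapply is_derive_ext_loc; [|exact F1].
    generalize (locally_line_x _ z Hloc). apply filter_imp. intros t Ht. symmetry. exact Ht.
  - eapply is_derive_ext_loc; [|exact F3].
    generalize (locally_line_y _ z Hloc). apply filter_imp. intros t Ht. symmetry. exact Ht.
Qed.

Lemma locally_disk_eq (f g : C -> R) (z : C) :
  disk z -> (forall p, disk p -> f p = g p) -> locally z (fun p => f p = g p).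
Proof. intros Hz H. generalize (locally_disk z Hz). apply filter_imp. exact H. Qed.

Lemma laplacian_of_harmonic (w W : C -> R) (z : C) :
  harmonic_real w -> (forall p, disk p -> W p = w p) -> disk z -> laplacian W z 0.
Proof.
  intros [(H1 & Hx & Hy) Hlap] HW Hz.
  apply laplacian_ext_loc with w.
  { apply locally_disk_eq; [exact Hz|]. intros p Hp. symmetry. auto. }
  exists (partial_x w), (partial_y w), (partial_x (partial_x w) z), (partial_y (partial_y w) z).
  split; [|split; [|split]].
  - generalize (locally_disk z Hz). apply filter_imp. intros p Hp.
    destruct (H1 p Hp) as (A & B & _). split; apply Derive_correct; assumption.
  - apply Derive_correct. apply (Hx z Hz).
  - apply Derive_correct. apply (Hy z Hz).
  - symmetry. exact (Hlap z Hz).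
Qed.

Lemma mixed_partials_eq (w : C -> R) (z : C) :
  C2_disk w -> disk z -> partial_x (partial_y w) z = partial_y (partial_x w) z.
Proof.
  intros (H1 & Hx & Hy) Hz. destruct z as [x y].
  unfold partial_x, partial_y. simpl.
  apply (Schwarz (fun x y => w (x, y)) x y).
  - apply locally_2d_locally. generalize (locally_disk _ Hz). apply filter_imp.
    intros p Hp. destruct (H1 p Hp) as (A1 & A2 & _). destruct (Hx p Hp) as (_ & B2 & _).
    destruct (Hy p Hp) as (C1 & _). repeat split; assumption.
  - apply continuity_2d_pt_filterlim. destruct (Hy _ Hz) as (_ & _ & C3 & _).
    eapply filterlim_ext; [|exact C3]. intros p. reflexivity.
  - apply continuity_2d_pt_filterlim. destruct (Hx _ Hz) as (_ & _ & _ & C4).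
    eapply filterlim_ext; [|exact C4]. intros p. reflexivity.
Qed.

(** If [w] is the real part of [Phi], then [Phi' = w_x - i w_y]. Its Cauchy-Riemann equations are
    [w_xx + w_yy = 0] and the symmetry of the mixed partial derivatives, so the second
    derivative of an analytic function whose real part is known to be [C^2] and harmonic
    comes without Cauchy's formula. *)
Lemma harmonic_cr_second (w : C -> R) (Phi Phi' : C -> C) (z : C) :
  harmonic_real w -> (forall p, disk p -> w p = Re (Phi p)) ->
  (forall p, disk p -> cr_derive Phi p (Phi' p)) -> disk z ->
  continuousC Phi' z /\ exists l, cr_derive Phi' z l.
Proof.
  intros [HC2 Hlap] Hw HPhi Hz.
  assert (Hp : forall p, disk p -> partial_x w p = Re (Phi' p) /\ partial_y w p = - Im (Phi' p)).
  { intros p Hp. apply (cr_derive_partials w Phi); [|auto]. apply locally_disk_eq; assumption. }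
  pose proof (mixed_partials_eq w z HC2 Hz) as Hmix. pose proof (Hlap z Hz) as Hl.
  destruct HC2 as (H1 & Hx & Hy).
  destruct (H1 z Hz) as (_ & _ & Cx & Cy).
  assert (Ex : locally z (fun p => partial_x w p = Re (Phi' p))).
  { apply locally_disk_eq; [exact Hz|]. intros p Hd. apply Hp, Hd. }
  assert (Ey : locally z (fun p => - partial_y w p = Im (Phi' p))).
  { apply (locally_disk_eq (fun p => - partial_y w p)); [exact Hz|].
    intros p Hd. destruct (Hp p Hd) as [_ E]. rewrite E. ring. }
  split.
  - split.
    + apply (continuous_ext_loc _ (partial_x w)); assumption.
    + apply (continuous_ext_loc _ (fun p => - partial_y w p)); [exact Ey|].
      apply (continuous_opp (partial_y w)). exact Cy.
  - destruct (Hx z Hz) as (A1 & A2 & _). destruct (Hy z Hz) as (B1 & B2 & _).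
    apply Derive_correct in A1, A2, B1, B2.
    fold (partial_x (partial_x w) z) in A1. fold (partial_y (partial_x w) z) in A2.
    fold (partial_x (partial_y w) z) in B1. fold (partial_y (partial_y w) z) in B2.
    exists (partial_x (partial_x w) z, - partial_x (partial_y w) z).
    split; split; simpl.
    + eapply is_derive_ext_loc; [|exact A1]. exact (locally_line_x _ z Ex).
    + eapply is_derive_ext_loc; [exact (locally_line_x _ z Ey)|].
      exact (is_derive_opp _ _ _ B1).
    + rewrite Ropp_involutive, Hmix.
      eapply is_derive_ext_loc; [|exact A2]. exact (locally_line_y _ z Ex).
    + replace (partial_x (partial_x w) z) with (- partial_y (partial_y w) z) by lra.
      eapply is_derive_ext_loc; [exact (locally_line_y _ z Ey)|].
      exact (is_derive_opp _ _ _ B2).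
Qed.

Lemma constant_of_derivative_zero (h h' : C -> C) (a : C) (r : R) :
  (forall p, Cmod (p - a) < r -> cr_derive h p (h' p) /\ h' p = 0) ->
  forall p, Cmod (p - a) < r -> h p = h a.
Proof.
  intros H p Hp.
  assert (Hmod : forall x y, Rabs (x - fst a) <= Rabs (fst p - fst a) ->
     Rabs (y - snd a) <= Rabs (snd p - snd a) -> Cmod ((x, y) - a) < r).
  { intros x y Hx Hy. apply Rle_lt_trans with (2 := Hp).
    pose proof (Cmod2_alt (p - a)) as E.
    apply Cmod_le_sq; [apply Cmod_ge_0|]. rewrite E.
    apply Rsqr_le_abs_1 in Hx, Hy. unfold Rsqr in Hx, Hy.
    destruct p, a. simpl in *. lra. }
  assert (Hline : forall f : R -> R, forall x y,
    (forall t, Rabs (t - x) <= Rabs (y - x) -> is_derive f t 0) -> f y = f x).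
  { intros f x y Hf.
    assert (Rabs (f y - f x) <= 0 * Rabs (y - x)).
    { apply bounded_variation with (dh := fun _ => 0). intros t Ht. split; [auto|].
      rewrite Rabs_R0. lra. }
    rewrite Rmult_0_l in H0. pose proof (Rabs_pos (f y - f x)).
    apply Rminus_diag_uniq. apply Rabs_eq_0. lra. }
  assert (E1 : h p = h (fst p, snd a)).
  { rewrite (surjective_pairing p) at 1.
    assert (D : forall t, Rabs (t - snd a) <= Rabs (snd p - snd a) ->
      is_derive (fun y => Re (h (fst p, y))) t 0 /\ is_derive (fun y => Im (h (fst p, y))) t 0).
    { intros t Ht. destruct (H (fst p, t)) as [[_ [D1 D2]] E].
      { apply Hmod; [lra|exact Ht]. }
      rewrite E in D1, D2. simpl in D1, D2. rewrite Ropp_0 in D1. split; assumption. }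
    apply injective_projections.
    - apply (Hline (fun y => Re (h (fst p, y)))). intros t Ht. apply D. exact Ht.
    - apply (Hline (fun y => Im (h (fst p, y)))). intros t Ht. apply D. exact Ht. }
  rewrite E1. rewrite (surjective_pairing a) at 2.
  assert (D : forall t, Rabs (t - fst a) <= Rabs (fst p - fst a) ->
    is_derive (fun x => Re (h (x, snd a))) t 0 /\ is_derive (fun x => Im (h (x, snd a))) t 0).
  { intros t Ht. destruct (H (t, snd a)) as [[[D1 D2] _] E].
    { apply Hmod; [exact Ht|]. rewrite Rminus_diag, Rabs_R0. apply Rabs_pos. }
    rewrite E in D1, D2. split; assumption. }
  apply injective_projections.
  - apply (Hline (fun x => Re (h (x, snd a)))). intros t Ht. apply D. exact Ht.
  - apply (Hline (fun x => Im (h (x, snd a)))). intros t Ht. apply D. exact Ht.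
Qed.

Lemma analytic_derive (h : C -> C) (z : C) : analytic h -> disk z ->
  @is_derive C_AbsRing C_NormedModule h z (C_derive h z).
Proof. intros Hh Hz. apply C_derive_correct; [exact z|]. apply Hh. exact Hz. Qed.

Lemma analytic_cr (h : C -> C) (z : C) : analytic h -> disk z -> cr_derive h z (C_derive h z).
Proof. intros Hh Hz. apply complex_derive_cr. apply analytic_derive; assumption. Qed.

Lemma cr_derive_ext (f g : C -> C) (z l : C) :
  (forall p, f p = g p) -> cr_derive f z l -> cr_derive g z l.
Proof.
  intros E [[F1 F2] [F3 F4]].
  split; split; eapply is_derive_ext; try eassumption; intros t; cbv beta; rewrite E; reflexivity.
Qed.

Lemma continuousC_ext (f g : C -> C) (z : C) :
  (forall p, f p = g p) -> continuousC f z -> continuousC g z.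
Proof.
  intros E [F1 F2]. split.
  - apply (continuousR_ext _ _ z (fun p => f_equal Re (E p)) F1).
  - apply (continuousR_ext _ _ z (fun p => f_equal Im (E p)) F2).
Qed.

(** The real part of [f] controls [h' + g'] and its imaginary part [h' - g']. *)
Lemma derivative_regularity (f h g : C -> C) (z : C) :
  harmonic f -> canonical_decomposition f h g -> disk z ->
  continuousC (C_derive h) z /\ continuousC (C_derive g) z /\
  exists l, cr_derive (C_derive h) z l.
Proof.
  intros [Hu Hv] (Hh & Hg & _ & Hf) Hz.
  set (F' := fun p => (C_derive h p + C_derive g p)%C).
  set (P' := fun p => (- Ci * (C_derive h p + RtoC (-1) * C_derive g p))%C).
  destruct (harmonic_cr_second _ (fun p => h p + g p)%C F' z Hu) as [CF [l Hl]]; trivial.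
  { intros p Hp. rewrite (Hf p Hp). destruct (h p), (g p). simpl. reflexivity. }
  { intros p Hp. apply cr_derive_plus; apply analytic_cr; assumption. }
  destruct (harmonic_cr_second _ (fun p => - Ci * (h p + RtoC (-1) * g p))%C P' z Hv)
    as [CP [m Hm]]; trivial.
  { intros p Hp. rewrite (Hf p Hp). destruct (h p), (g p). simpl. ring. }
  { intros p Hp. unfold P'.
    eapply cr_derive_eq.
    - apply (cr_derive_mult (fun _ => (- Ci)%C)); [apply cr_derive_const|].
      apply cr_derive_plus; [apply analytic_cr; assumption|].
      apply (cr_derive_mult (fun _ => RtoC (-1))); [apply cr_derive_const|].
      apply analytic_cr; assumption.
    - cbv beta. ring. }
  assert (Ei : (Ci * Ci)%C = RtoC (-1)).
  { unfold Ci, Cmult, RtoC. simpl. f_equal; ring. }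
  assert (H1 : forall x y : C, (Ci * (- Ci * (x + RtoC (-1) * y)))%C = (x - y)%C).
  { intros x y. replace (Ci * (- Ci * (x + RtoC (-1) * y)))%C with
      (- (Ci * Ci) * (x + RtoC (-1) * y))%C by ring. rewrite Ei.
    destruct x, y. unfold Cminus, Cmult, Cplus, Copp, RtoC. simpl. f_equal; ring. }
  assert (Eh : forall p, (RtoC (1 / 2) * (F' p + Ci * P' p))%C = C_derive h p).
  { intros p. unfold F', P'. rewrite H1.
    destruct (C_derive h p), (C_derive g p). unfold Cminus, Cmult, Cplus, Copp, RtoC. simpl. f_equal; field. }
  assert (Eg : forall p, (RtoC (1 / 2) * (F' p + - Ci * P' p))%C = C_derive g p).
  { intros p. replace (- Ci * P' p)%C with (- (Ci * P' p))%C by ring. unfold F', P'. rewrite H1.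
    destruct (C_derive h p), (C_derive g p). unfold Cminus, Cmult, Cplus, Copp, RtoC. simpl. f_equal; field. }
  split; [|split].
  - apply (continuousC_ext _ _ z Eh).
    apply continuousC_mult; [apply continuousC_const|].
    apply continuousC_plus; [exact CF|]. apply continuousC_mult; [apply continuousC_const|exact CP].
  - apply (continuousC_ext _ _ z Eg).
    apply continuousC_mult; [apply continuousC_const|].
    apply continuousC_plus; [exact CF|]. apply continuousC_mult; [apply continuousC_const|exact CP].
  - eexists. apply (cr_derive_ext _ _ z _ Eh).
    apply (cr_derive_mult (fun _ => RtoC (1 / 2))); [apply cr_derive_const|].
    apply (cr_derive_plus F'); [exact Hl|].
    apply (cr_derive_mult (fun _ => Ci)); [apply cr_derive_const|exact Hm].
Qed.

(** Were [h'] zero near [a], [h - h a] would vanish near [a], hence everywhere. The identity theorem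
    is applied to [h] rather than [h'] because it needs two derivatives and [h'] is only known
    to have one. *)
Lemma derivative_zeros_nowhere_dense (f h g : C -> C) (a : C) :
  harmonic f -> canonical_decomposition f h g ->
  (exists z, disk z /\ C_derive h z <> 0) -> disk a ->
  ~ locally a (fun p => C_derive h p = 0).
Proof.
  intros Hf Hdec (z1 & Hz1 & Hne) Ha Hloc.
  pose proof (filter_and _ _ (locally_disk a Ha) Hloc) as [e He].
  assert (Hh : analytic h) by apply Hdec.
  assert (Hball : forall p, Cmod (p - a) < e -> disk p /\ C_derive h p = 0).
  { intros p Hp. apply He. exact (C_NormedModule_mixin_compat1 a p e Hp). }
  assert (Hconst : forall p, Cmod (p - a) < e -> h p = h a).
  { apply (constant_of_derivative_zero h (C_derive h) a e). intros p Hp.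
    destruct (Hball p Hp) as [H1 H2]. split; [|exact H2]. apply analytic_cr; assumption. }
  assert (Hall : forall z, disk z -> (h z + - h a)%C = 0).
  { apply (identity_theorem _ a e).
    - intros z Hz. destruct (derivative_regularity f h g z Hf Hdec Hz) as (_ & _ & l & Hl).
      exists (C_derive h), l. split; [|exact Hl].
      generalize (locally_disk z Hz). apply filter_imp. intros p Hp.
      apply cr_derive_eq with (C_derive h p + 0)%C; [|ring].
      apply cr_derive_plus; [apply analytic_cr; assumption|apply cr_derive_const].
    - intros z Hz. apply continuousC_plus; [|apply continuousC_const].
      apply (complex_derive_continuousC h z (C_derive h z)). apply analytic_derive; assumption.
    - exact Ha.
    - apply cond_pos.
    - intros p Hp. rewrite (Hconst p Hp). ring. }
  apply Hne.
  assert (Hval : forall z, disk z -> h z = h a).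
  { intros z Hz. replace (h z) with (h z + - h a + h a)%C by ring. rewrite (Hall z Hz). ring. }
  pose proof (analytic_cr h z1 Hh Hz1) as D.
  destruct (cr_derive_partials (fun p => Re (h a)) h z1 (C_derive h z1)) with (2 := D) as [E1 E2].
  { generalize (locally_disk z1 Hz1). apply filter_imp. intros p Hp. rewrite (Hval p Hp). reflexivity. }
  unfold partial_x in E1. unfold partial_y in E2. rewrite Derive_const in E1, E2.
  destruct (C_derive h z1) as [x y]. simpl in E1, E2. unfold RtoC. f_equal; lra.
Qed.

(** At a zero of [h'] the bound follows by continuity, as the zeros of [h'] have
    empty interior. *)
Lemma dilatation_bound (f h g omega : C -> C) (k : R) :
  harmonic f -> canonical_decomposition f h g -> complex_dilatation h g omega ->
  0 <= k -> (forall z, disk z -> Cmod (omega z) <= k) ->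
  forall z, disk z -> Cmod (C_derive g z) <= k * Cmod (C_derive h z).
Proof.
  intros Hf Hdec (Hne & _ & Hom) Hk Hbd z Hz.
  apply Rnot_lt_le. intros Hlt.
  destruct (derivative_regularity f h g z Hf Hdec Hz) as (Ch & Cg & _).
  apply continuous_Cmod2 in Ch. apply continuous_Cmod2 in Cg.
  set (D := fun p => Cmod (C_derive g p) ^ 2 + - k ^ 2 * Cmod (C_derive h p) ^ 2).
  assert (HD : continuous D z).
  { apply continuous_plusR; [exact Cg|]. apply continuous_multR; [apply continuous_const|exact Ch]. }
  assert (HDz : 0 < D z).
  { unfold D. pose proof (Cmod_ge_0 (C_derive h z)). pose proof (Cmod_ge_0 (C_derive g z)).
    assert (0 <= k * Cmod (C_derive h z)) by (apply Rmult_le_pos; assumption). nra. }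
  apply (derivative_zeros_nowhere_dense f h g z Hf Hdec Hne Hz).
  generalize (filter_and _ _ (locally_disk z Hz) (HD (fun x => 0 < x) (open_gt 0 (D z) HDz))).
  apply (filter_imp (fun p => disk p /\ 0 < D p)). intros p [Hp HDp]. apply NNPP. intros Hn.
  specialize (Hom p Hp Hn). specialize (Hbd p Hp).
  assert (E : C_derive g p = (omega p * C_derive h p)%C).
  { rewrite Hom. field. exact Hn. }
  unfold D in HDp. rewrite E, Cmod_mult in HDp.
  pose proof (Cmod_ge_0 (omega p)). pose proof (Cmod_ge_0 (C_derive h p)).
  assert (Cmod (omega p) ^ 2 <= k ^ 2) by nra.
  assert (0 <= Cmod (C_derive h p) ^ 2) by nra. nra.
Qed.

(** With [k = (K - 1) / (K + 1)] one has [|x - y| <= (1 + k) |x|], [|x + y| >= (1 - k) |x|] and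
    [(1 + k) / (1 - k) = K]. *)
Lemma quasiregular_gradient (K : R) (x y : C) : 1 <= K ->
  Cmod y <= (K - 1) / (K + 1) * Cmod x -> Cmod (x - y) <= K * Cmod (x + y).
Proof.
  intros HK H.
  pose proof (Cmod_triangle x (- y)) as T1. rewrite Cmod_opp in T1.
  pose proof (Cmod_triangle (x + y) (- y)) as T2. rewrite Cmod_opp in T2.
  replace (x + y + - y)%C with x in T2 by ring.
  change (x + - y)%C with (x - y)%C in T1.
  apply (Rmult_le_compat_l (K + 1)) in H; [|lra].
  replace ((K + 1) * ((K - 1) / (K + 1) * Cmod x)) with ((K - 1) * Cmod x) in H by (field; lra).
  pose proof (Cmod_ge_0 x). pose proof (Cmod_ge_0 y). nra.
Qed.

(** * From gradient growth to Hoelder continuity *)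

Lemma Rpower_ge_base (l a : R) : 0 < l <= 1 -> 0 < a < 1 -> l <= Rpower l a.
Proof.
  intros Hl Ha. unfold Rpower. rewrite <- (exp_ln l) at 1 by lra.
  assert (ln l <= 0). { rewrite <- ln_1. apply ln_le; lra. }
  destruct (Req_dec (ln l) 0) as [E|E]; [rewrite E; right; f_equal; ring|].
  left. apply exp_increasing. nra.
Qed.

Lemma hpow_subadditive (x y a : R) : 0 < a < 1 -> 0 <= x -> 0 <= y ->
  hpow (x + y) a <= hpow x a + hpow y a.
Proof.
  intros Ha Hx Hy.
  destruct (Req_dec x 0) as [->|Hx0]. { rewrite hpow_0, !Rplus_0_l. lra. }
  destruct (Req_dec y 0) as [->|Hy0]. { rewrite hpow_0, !Rplus_0_r. lra. }
  set (S := x + y). assert (HS : 0 < S) by (unfold S; lra).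
  assert (K : forall t, 0 < t <= S -> t / S * hpow S a <= hpow t a).
  { intros t Ht. replace t with (t / S * S) at 2 by (field; lra).
    assert (Hq : 0 < t / S <= 1).
    { split; [apply Rdiv_lt_0_compat; lra|]. apply Rle_div_l; lra. }
    rewrite hpow_mult by lra. apply Rmult_le_compat_r; [apply hpow_ge_0|].
    rewrite hpow_pos by lra. apply Rpower_ge_base; assumption. }
  pose proof (K x ltac:(unfold S; lra)). pose proof (K y ltac:(unfold S; lra)).
  replace (hpow S a) with (x / S * hpow S a + y / S * hpow S a); [lra|].
  unfold S. field. lra.
Qed.

Lemma hpow_small (a eps : R) : 0 < a -> 0 < eps ->
  exists d : posreal, forall t, 0 <= t < d -> hpow t a < eps.
Proof.
  intros Ha He. exists (mkposreal (Rpower eps (/ a)) (exp_pos _)). simpl. intros t Ht.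
  destruct (Req_dec t 0) as [->|Ht0]; [rewrite hpow_0; exact He|].
  rewrite hpow_pos by lra.
  replace eps with (Rpower (Rpower eps (/ a)) a).
  - apply Rlt_Rpower_l; lra.
  - rewrite Rpower_mult, Rinv_l, Rpower_1 by lra. reflexivity.
Qed.

Lemma Rpower_decreasing (s t b : R) : 0 < s <= t -> b <= 0 -> Rpower t b <= Rpower s b.
Proof.
  intros Hs Hb. unfold Rpower.
  assert (ln s <= ln t) by (apply ln_le; lra).
  destruct (Req_dec (b * ln t) (b * ln s)) as [E|E]; [rewrite E; lra|].
  left. apply exp_increasing. nra.
Qed.

Lemma dominated_increment (f df g dg : R -> R) (a b : R) : a <= b ->
  (forall t, a <= t <= b -> is_derive f t (df t)) ->
  (forall t, a <= t <= b -> is_derive g t (dg t)) ->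
  (forall t, a <= t <= b -> Rabs (df t) <= dg t) ->
  Rabs (f b - f a) <= g b - g a.
Proof.
  intros Hab Hf Hg Hle.
  assert (K : forall e, Rabs e = 1 -> 0 <= (g b - g a) - e * (f b - f a)).
  { intros e He.
    destruct (MVT_gen (fun t => g t - e * f t) a b (fun t => dg t - e * df t)) as [c [Hc1 Hc2]].
    - rewrite Rmin_left, Rmax_right by lra. intros x Hx.
      apply (is_derive_minus g (fun t => e * f t)); [apply Hg; lra|].
      apply is_derive_scal. apply Hf. lra.
    - rewrite Rmin_left, Rmax_right by lra. intros x Hx.
      apply continuity_pt_filterlim. apply (ex_derive_continuous (fun t => g t - e * f t)).
      exists (dg x - e * df x).
      apply (is_derive_minus g (fun t => e * f t)); [apply Hg; lra|].
      apply is_derive_scal. apply Hf. lra.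
    - rewrite Rmin_left, Rmax_right in Hc1 by lra.
      replace (g b - g a - e * (f b - f a)) with ((dg c - e * df c) * (b - a)) by lra.
      apply Rmult_le_pos; [|lra]. specialize (Hle c Hc1).
      pose proof (Rle_abs (e * df c)) as Hr. rewrite Rabs_mult, He in Hr. lra. }
  pose proof (K 1 Rabs_R1). pose proof (K (-1) ltac:(rewrite Rabs_left; lra)).
  apply Rabs_le. lra.
Qed.

(** Along the ray, [B |z| (1 - t |z|)^(alpha - 1)] has the primitive
    [- (B / alpha) (1 - t |z|)^alpha], whose increment is bounded by subadditivity of the
    power. *)
Lemma radial_increment (alpha B : R) (G G' : C -> C) (z : C) (s : R)
  (Ha : 0 < alpha < 1) (HB : 0 <= B)
  (HG : forall p, disk p -> @is_derive C_AbsRing C_NormedModule G p (G' p))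
  (Hgrow : forall p, disk p -> Cmod (G' p) <= B * Rpower (1 - Cmod p) (alpha - 1))
  (Hz : disk z) (Hs : 0 <= s <= 1) :
  Rabs (Im (G z) - Im (G (RtoC (1 - s) * z)%C)) <= B / alpha * hpow s alpha.
Proof.
  unfold disk in Hz. set (m := Cmod z) in *. pose proof (Cmod_ge_0 z) as Hm0. fold m in Hm0.
  assert (Hmod : forall t, 1 - s <= t <= 1 -> Cmod (RtoC t * z) = t * m /\ t * m <= m).
  { intros t Ht. rewrite Cmod_mult, Cmod_R, Rabs_right by lra. fold m. split; [reflexivity|nra]. }
  pose proof (dominated_increment
    (fun t => Im (G (0 + RtoC t * z)%C)) (fun t => Im (z * G' (RtoC t * z))%C)
    (fun t => - (B / alpha) * Rpower (1 - t * m) alpha)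
    (fun t => B * m * Rpower (1 - t * m) (alpha - 1)) (1 - s) 1 ltac:(lra)) as Hinc.
  assert (H0 : forall t : R, (0 + RtoC t * z)%C = (RtoC t * z)%C) by (intros; ring).
  cbv beta in Hinc. rewrite !H0 in Hinc. rewrite Cmult_1_l in Hinc.
  apply Rle_trans with (1 := Hinc
     ltac:(intros t Ht; destruct (Hmod t Ht) as [E1 E2];
           apply (complex_derive_line G 0 z (G' (RtoC t * z)%C) t); rewrite H0; apply HG;
           unfold disk; lra)
     ltac:(intros t Ht; destruct (Hmod t Ht) as [E1 E2]; unfold Rpower; auto_derive;
       [lra|]; replace (exp ((alpha - 1) * ln (1 - t * m))) with
         (exp (alpha * ln (1 - t * m)) * / (1 - t * m));
       [change (1 + - (t * m)) with (1 - t * m); field; lra|];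
       replace ((alpha - 1) * ln (1 - t * m)) with (alpha * ln (1 - t * m) + - ln (1 - t * m)) by ring;
       rewrite exp_plus, exp_Ropp, exp_ln by lra; reflexivity)
     ltac:(intros t Ht; destruct (Hmod t Ht) as [E1 E2];
       apply Rle_trans with (1 := im_le_Cmod _); rewrite Cmod_mult; fold m;
       specialize (Hgrow (RtoC t * z)%C); rewrite E1 in Hgrow;
       specialize (Hgrow ltac:(unfold disk; lra)); nra)).
  rewrite Rmult_1_l.
  pose proof (hpow_subadditive (1 - m) (s * m) alpha Ha ltac:(lra) ltac:(nra)) as Hsub.
  rewrite (hpow_pos (1 - m)) in Hsub by lra.
  replace (1 - m + s * m) with (1 - (1 - s) * m) in Hsub by ring.
  rewrite (hpow_pos (1 - (1 - s) * m)) in Hsub by nra.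
  pose proof (hpow_le (s * m) s alpha ltac:(lra) ltac:(nra)) as Hle.
  assert (HBa : 0 <= B / alpha).
  { unfold Rdiv. apply Rmult_le_pos; [lra|]. left. apply Rinv_0_lt_compat. lra. }
  nra.
Qed.

Lemma segment_increment (alpha B : R) (G G' : C -> C) (p q : C) (s : R)
  (Ha : 0 < alpha < 1) (HB : 0 <= B) (Hs : 0 < s)
  (HG : forall p, disk p -> @is_derive C_AbsRing C_NormedModule G p (G' p))
  (Hgrow : forall p, disk p -> Cmod (G' p) <= B * Rpower (1 - Cmod p) (alpha - 1))
  (Hp : Cmod p <= 1 - s) (Hq : Cmod q <= 1 - s) :
  Rabs (Im (G q) - Im (G p)) <= B * Rpower s (alpha - 1) * Cmod (q - p).
Proof.
  set (D := B * Rpower s (alpha - 1) * Cmod (q - p)).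
  assert (Hmod : forall t, 0 <= t <= 1 -> Cmod (p + RtoC t * (q - p)) <= 1 - s).
  { intros t Ht. replace (p + RtoC t * (q - p))%C with (RtoC (1 - t) * p + RtoC t * q)%C.
    2: { rewrite RtoC_minus. ring. }
    apply Rle_trans with (1 := Cmod_triangle _ _).
    rewrite !Cmod_mult, !Cmod_R, !Rabs_right by lra. nra. }
  assert (Hinc : Rabs (Im (G (p + RtoC 1 * (q - p))%C) - Im (G (p + RtoC 0 * (q - p))%C)) <= D * 1 - D * 0).
  { apply (dominated_increment
      (fun t => Im (G (p + RtoC t * (q - p))%C))
      (fun t => Im ((q - p) * G' (p + RtoC t * (q - p)))%C) (fun t => D * t) (fun _ => D)); [lra| | |].
    - intros t Ht. specialize (Hmod t Ht).
      apply (complex_derive_line G p (q - p) (G' (p + RtoC t * (q - p))%C) t). apply HG.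
      unfold disk. lra.
    - intros t Ht. auto_derive; trivial; ring.
    - intros t Ht. specialize (Hmod t Ht).
      apply Rle_trans with (1 := im_le_Cmod _). rewrite Cmod_mult.
      specialize (Hgrow (p + RtoC t * (q - p))%C ltac:(unfold disk; lra)).
      assert (Rpower (1 - Cmod (p + RtoC t * (q - p))) (alpha - 1) <= Rpower s (alpha - 1)).
      { apply Rpower_decreasing; lra. }
      pose proof (Cmod_ge_0 (q - p)). unfold D.
      rewrite Rmult_comm. apply Rmult_le_compat_r; [assumption|].
      apply Rle_trans with (1 := Hgrow). apply Rmult_le_compat_l; assumption. }
  replace (p + RtoC 1 * (q - p))%C with q in Hinc by ring.
  replace (p + RtoC 0 * (q - p))%C with p in Hinc by ring.
  lra.
Qed.

(** With [s = |z - w|], both points are first moved to the factor [1 - s] of themselves, where the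
    gradient is at most [B s^(alpha - 1)], and then joined by a segment of length at most
    [s]. For [s >= 1] both are moved to the center. *)
Lemma hardy_littlewood (alpha B : R) (G G' : C -> C)
  (Ha : 0 < alpha < 1) (HB : 0 <= B)
  (HG : forall p, disk p -> @is_derive C_AbsRing C_NormedModule G p (G' p))
  (Hgrow : forall p, disk p -> Cmod (G' p) <= B * Rpower (1 - Cmod p) (alpha - 1)) :
  forall z w, disk z -> disk w ->
  Rabs (Im (G z) - Im (G w)) <= (2 * B / alpha + B) * hpow (Cmod (z - w)) alpha.
Proof.
  intros z w Hz Hw. set (s := Cmod (z - w)).
  assert (HBa : 0 <= B / alpha).
  { unfold Rdiv. apply Rmult_le_pos; [lra|]. left. apply Rinv_0_lt_compat. lra. }
  replace (2 * B / alpha) with (2 * (B / alpha)) by (field; lra).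
  destruct (Req_dec s 0) as [E|E].
  { assert (z = w) as ->.
    { replace z with (z - w + w)%C by ring. rewrite (Cmod_eq_0 _ E). ring. }
    rewrite Rminus_diag, Rabs_R0. apply Rmult_le_pos; [lra|apply hpow_ge_0]. }
  assert (Hs : 0 < s) by (pose proof (Cmod_ge_0 (z - w)); unfold s in *; lra).
  set (s' := Rmin s 1).
  assert (Hs' : 0 <= s' <= 1 /\ s' <= s).
  { unfold s'. pose proof (Rmin_l s 1). pose proof (Rmin_r s 1).
    pose proof (Rmin_glb_lt s 1 0 Hs ltac:(lra)). lra. }
  pose proof (radial_increment alpha B G G' z s' Ha HB HG Hgrow Hz (proj1 Hs')) as Hz'.
  pose proof (radial_increment alpha B G G' w s' Ha HB HG Hgrow Hw (proj1 Hs')) as Hw'.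
  pose proof (hpow_le s' s alpha ltac:(lra) ltac:(lra)) as Hh.
  assert (Hmid : Rabs (Im (G (RtoC (1 - s') * z)%C) - Im (G (RtoC (1 - s') * w)%C)) <= B * hpow s alpha).
  { destruct (Rle_lt_dec 1 s) as [H1|H1].
    - assert (s' = 1) as -> by (apply Rmin_right; lra).
      replace (RtoC (1 - 1) * z)%C with (RtoC (1 - 1) * w)%C by (rewrite Rminus_diag; ring).
      rewrite Rminus_diag, Rabs_R0. apply Rmult_le_pos; [lra|apply hpow_ge_0].
    - assert (s' = s) as E' by (apply Rmin_left; lra). rewrite E'.
      assert (Hm : forall x, disk x -> Cmod (RtoC (1 - s) * x) <= 1 - s).
      { intros x Hx. rewrite Cmod_mult, Cmod_R, Rabs_right by lra. unfold disk in Hx. nra. }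
      apply Rle_trans with (1 := segment_increment alpha B G G' (RtoC (1 - s) * w)
        (RtoC (1 - s) * z) s Ha HB Hs HG Hgrow (Hm w Hw) (Hm z Hz)).
      replace (RtoC (1 - s) * z - RtoC (1 - s) * w)%C with (RtoC (1 - s) * (z - w))%C by ring.
      rewrite Cmod_mult, Cmod_R, Rabs_right by lra. fold s.
      rewrite hpow_pos by lra.
      replace (Rpower s alpha) with (Rpower s (alpha - 1) * s).
      2: { rewrite <- (Rpower_1 s) at 2 by lra. rewrite <- Rpower_plus. f_equal. ring. }
      rewrite Rmult_assoc. apply Rmult_le_compat_l; [lra|].
      apply Rmult_le_compat_l; [left; apply exp_pos|]. nra. }
  apply Rabs_le_between in Hz', Hw', Hmid. apply Rabs_le. nra.
Qed.

Lemma continuous_on_of_holder (alpha A : R) (V : C -> R) (S : C -> Prop) :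
  0 < alpha -> 0 <= A ->
  (forall z w, Rabs (V z - V w) <= A * hpow (Cmod (z - w)) alpha) -> continuous_on S V.
Proof.
  intros Ha HA HV. apply continuous_on_forall. intros z _.
  apply filterlim_locally. intros eps.
  assert (He : 0 < eps / (A + 1)) by (apply Rdiv_lt_0_compat; [apply cond_pos|lra]).
  destruct (hpow_small alpha _ Ha He) as [d Hd].
  generalize (locally_C_lt z d). apply filter_imp. intros p Hp.
  change (Rabs (V p - V z) < eps).
  apply Rle_lt_trans with (1 := HV p z).
  specialize (Hd (Cmod (p - z)) (conj (Cmod_ge_0 _) Hp)).
  pose proof (hpow_ge_0 (Cmod (p - z)) alpha).
  apply Rle_lt_trans with ((A + 1) * hpow (Cmod (p - z)) alpha); [nra|].
  apply Rmult_lt_compat_l with (r := A + 1) in Hd; [|lra].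
  replace ((A + 1) * (eps / (A + 1))) with (pos eps) in Hd by (field; lra). exact Hd.
Qed.

(** McShane's extension: for [alpha < 1], [|z - w| ^ alpha] is a metric, so the supremum over [w] in
    [D] of [v w - A |z - w| ^ alpha] satisfies the same Hoelder condition as [v]. *)
Lemma holder_extension (alpha A : R) (D : C -> Prop) (v : C -> R) :
  0 < alpha < 1 -> 0 <= A -> D 0 ->
  (forall z w, D z -> D w -> Rabs (v z - v w) <= A * hpow (Cmod (z - w)) alpha) ->
  exists V : C -> R, (forall z, D z -> V z = v z) /\
    forall z w, Rabs (V z - V w) <= A * hpow (Cmod (z - w)) alpha.
Proof.
  intros Ha HA D0 Hv.
  assert (Htri : forall x y z, hpow (Cmod (x - z)) alpha <=
     hpow (Cmod (x - y)) alpha + hpow (Cmod (y - z)) alpha).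
  { intros x y z.
    apply Rle_trans with (2 := hpow_subadditive _ _ _ Ha (Cmod_ge_0 _) (Cmod_ge_0 _)).
    apply hpow_le; [lra|]. split; [apply Cmod_ge_0|].
    replace (x - z)%C with (x - y + (y - z))%C by ring. apply Cmod_triangle. }
  set (E := fun z y => exists w, D w /\ y = v w - A * hpow (Cmod (z - w)) alpha).
  assert (Hub : forall z0 z w, D w -> D z0 ->
     v w - A * hpow (Cmod (z - w)) alpha <= v z0 + A * hpow (Cmod (z - z0)) alpha).
  { intros z0 z w Hw Hz0. pose proof (Hv w z0 Hw Hz0) as H. apply Rabs_le_between in H.
    pose proof (Htri w z z0) as T. rewrite (Cmod_minus_sym w z) in T. nra. }
  assert (Hlub : forall z, {m : R | is_lub (E z) m}).
  { intros z. apply completeness.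
    - exists (v 0 + A * hpow (Cmod (z - 0)) alpha). intros y (w & Hw & ->). apply Hub; assumption.
    - exists (v 0 - A * hpow (Cmod (z - 0)) alpha). exists (RtoC 0). auto. }
  exists (fun z => proj1_sig (Hlub z)).
  assert (Hup : forall z w, proj1_sig (Hlub z) - proj1_sig (Hlub w) <= A * hpow (Cmod (z - w)) alpha).
  { intros z w. destruct (Hlub z) as [m [Hm1 Hm2]], (Hlub w) as [m' [Hm1' Hm2']]. simpl.
    assert (m <= m' + A * hpow (Cmod (z - w)) alpha); [|lra].
    apply Hm2. intros y (x & Hx & ->).
    assert (v x - A * hpow (Cmod (w - x)) alpha <= m') by (apply Hm1'; exists x; auto).
    pose proof (Htri w z x) as T. rewrite (Cmod_minus_sym w z) in T. nra. }
  split.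
  - intros z Hz. destruct (Hlub z) as [m [Hm1 Hm2]]. simpl.
    assert (E0 : Cmod (z - z) = 0) by (replace (z - z)%C with (RtoC 0) by ring; apply Cmod_0).
    apply Rle_antisym.
    + apply Hm2. intros y (w & Hw & ->). pose proof (Hub z z w Hw Hz) as H.
      rewrite E0, hpow_0 in H. lra.
    + apply Hm1. exists z. rewrite E0, hpow_0. split; [exact Hz|ring].
  - intros z w. apply Rabs_le. pose proof (Hup z w). pose proof (Hup w z) as H'.
    rewrite (Cmod_minus_sym w z) in H'. lra.
Qed.

(** * Arcs, chords and the theorem *)

Lemma expi_plus (s t : R) : expi (s + t) = (expi s * expi t)%C.
Proof.
  unfold expi, Cmult. simpl. rewrite cos_plus, sin_plus. f_equal; ring.
Qed.

Lemma lipschitz_of_derivative (f df : R -> R) :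
  (forall t, is_derive f t (df t)) -> (forall t, Rabs (df t) <= 1) ->
  forall x y, Rabs (f x - f y) <= Rabs (x - y).
Proof.
  intros Hf Hd x y. rewrite <- (Rmult_1_l (Rabs (x - y))).
  apply bounded_variation with (dh := df). intros t _. split; auto.
Qed.

Lemma chord_le_arc (x y : R) : Cmod (expi x - expi y) <= 2 * Rabs (x - y).
Proof.
  apply Rle_trans with (1 := Cmod_le_parts _). simpl.
  assert (Rabs (cos x - cos y) <= Rabs (x - y)).
  { apply lipschitz_of_derivative with (df := fun t => - sin t).
    - intros t. auto_derive; trivial; ring.
    - intros t. rewrite Rabs_Ropp. apply Rabs_le. apply SIN_bound. }
  assert (Rabs (sin x - sin y) <= Rabs (x - y)); [|unfold Rminus in *; lra].
  apply lipschitz_of_derivative with (df := cos).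
  - intros t. auto_derive; trivial; ring.
  - intros t. apply Rabs_le. apply COS_bound.
Qed.

(** The angle of [p = (c, s)] is [2 atan (s / (1 + c))] by the half-angle substitution. For
    [c >= 0] it is at most [2 |s|]; for [c < 0] it is at most [PI <= 4], while the chord is at least [1]. *)
Lemma circle_angle (p : C) : Cmod p = 1 ->
  exists phi, p = expi phi /\ Rabs phi <= 4 * Cmod (p - 1).
Proof.
  intros Hp. destruct p as [c s].
  assert (E : c ^ 2 + s ^ 2 = 1).
  { pose proof (Cmod2_alt (c, s)) as H. rewrite Hp in H. simpl in *. lra. }
  assert (Hre : Rabs (c - 1) <= Cmod ((c, s) - 1)) by exact (re_le_Cmod ((c, s) - 1)%C).
  assert (Him : Rabs s <= Cmod ((c, s) - 1)).
  { pose proof (im_le_Cmod ((c, s) - 1)%C) as H. simpl in H.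
    replace (s + - 0) with s in H by ring. exact H. }
  assert (Hc : -1 <= c <= 1) by nra.
  rewrite Rabs_left1 in Hre by lra.
  pose proof PI_4. pose proof PI_RGT_0.
  destruct (Req_dec c (-1)) as [->|Hne].
  - exists PI. split.
    + unfold expi. rewrite cos_PI, sin_PI. f_equal. nra.
    + rewrite Rabs_right by lra. lra.
  - set (t := s / (1 + c)). exists (2 * atan t).
    assert (Ht : 1 + t ^ 2 = 2 / (1 + c)).
    { unfold t. replace (1 + (s / (1 + c)) ^ 2) with (((1 + c) ^ 2 + s ^ 2) / (1 + c) ^ 2) by (field; lra).
      replace ((1 + c) ^ 2 + s ^ 2) with (2 * (1 + c)) by nra. field. lra. }
    assert (Hs : 0 < 1 + t ^ 2) by nra.
    assert (Hsq : sqrt (1 + t²) * sqrt (1 + t²) = 1 + t ^ 2).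
    { rewrite sqrt_sqrt by (pose proof (Rle_0_sqr t); lra). unfold Rsqr. ring. }
    assert (Hs0 : sqrt (1 + t²) <> 0) by (intros E0; rewrite E0 in Hsq; lra).
    split.
    + unfold expi. rewrite cos_2a, sin_2a, cos_atan, sin_atan.
      set (r := sqrt (1 + t²)) in *. f_equal.
      * replace (1 / r * (1 / r) - t / r * (t / r)) with ((1 - t ^ 2) / (r * r)) by (field; exact Hs0).
        rewrite Hsq, Ht. replace (1 - t ^ 2) with (2 - 2 / (1 + c)) by lra. field. lra.
      * replace (2 * (t / r) * (1 / r)) with (2 * t / (r * r)) by (field; exact Hs0).
        rewrite Hsq, Ht. unfold t. field. lra.
    + rewrite Rabs_mult, (Rabs_right 2) by lra.
      destruct (Rle_lt_dec 0 c) as [Hc0|Hc0].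
      * assert (Rabs (atan t) <= Rabs t).
        { pose proof (lipschitz_of_derivative atan (fun x => / (1 + x ^ 2))) as L.
          specialize (L ltac:(intros x; auto_derive; trivial; field; nra)).
          specialize (L ltac:(intros x; pose proof (pow2_ge_0 x);
            rewrite Rabs_right; [rewrite <- Rinv_1; apply Rinv_le_contravar; lra|
              left; apply Rinv_0_lt_compat; lra]) t 0).
          rewrite atan_0, !Rminus_0_r in L. exact L. }
        assert (Rabs t <= Rabs s).
        { unfold t, Rdiv. rewrite Rabs_mult.
          rewrite <- (Rmult_1_r (Rabs s)) at 2. apply Rmult_le_compat_l; [apply Rabs_pos|].
          rewrite Rabs_right by (left; apply Rinv_0_lt_compat; lra).
          rewrite <- Rinv_1. apply Rinv_le_contravar; lra. }
        pose proof (Cmod_ge_0 ((c, s) - 1)). lra.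
      * pose proof (atan_bound t).
        assert (Rabs (atan t) <= PI / 2) by (apply Rabs_le; lra). lra.
Qed.

(** Angles are chosen for the two points together: independent choices could differ by a full
    turn. *)
Lemma arc_le_chord (p q : C) : Cmod p = 1 -> Cmod q = 1 ->
  exists x y, p = expi x /\ q = expi y /\ Rabs (x - y) <= 4 * Cmod (p - q).
Proof.
  intros Hp Hq.
  assert (Hq0 : q <> 0) by (apply Cmod_gt_0; lra).
  destruct (circle_angle q Hq) as (y & Ey & _).
  destruct (circle_angle (p / q)) as (phi & Ephi & Hphi).
  { rewrite Cmod_div, Hp, Hq by exact Hq0. field. }
  exists (y + phi), y. split; [|split; [exact Ey|]].
  - rewrite expi_plus, <- Ey, <- Ephi. field. exact Hq0.
  - replace (y + phi - y) with phi by ring.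
    replace (Cmod (p - q)) with (Cmod (p / q - 1)); [exact Hphi|].
    replace (p - q)%C with ((p / q - 1) * q)%C by (field; exact Hq0).
    rewrite Cmod_mult, Hq. ring.
Qed.

Lemma Lambda_chord (alpha : R) (U : C -> R) : 0 < alpha ->
  Lambda alpha (fun theta => RtoC (U (expi theta))) ->
  exists A, 0 <= A /\ forall p q, Cmod p = 1 -> Cmod q = 1 ->
    Rabs (U p - U q) <= A * hpow (Cmod (p - q)) alpha.
Proof.
  intros Ha (A & HA & H). exists (A * hpow 4 alpha). split.
  { apply Rmult_le_pos; [lra|apply hpow_ge_0]. }
  intros p q Hp Hq. destruct (arc_le_chord p q Hp Hq) as (x & y & -> & -> & Hxy).
  specialize (H x y). rewrite <- RtoC_minus, Cmod_R in H.
  apply Rle_trans with (1 := H). rewrite Rmult_assoc. apply Rmult_le_compat_l; [lra|].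
  rewrite <- hpow_mult by (try apply Cmod_ge_0; lra).
  apply hpow_le; [exact Ha|]. split; [apply Rabs_pos|exact Hxy].
Qed.

Lemma chord_Lambda (alpha A : R) (V : C -> R) : 0 < alpha -> 0 <= A ->
  (forall z w, Rabs (V z - V w) <= A * hpow (Cmod (z - w)) alpha) ->
  Lambda alpha (fun theta => RtoC (V (expi theta))).
Proof.
  intros Ha HA HV. exists (A * hpow 2 alpha + 1). split.
  { pose proof (hpow_ge_0 2 alpha). nra. }
  intros x y. rewrite <- RtoC_minus, Cmod_R.
  apply Rle_trans with (1 := HV _ _).
  pose proof (chord_le_arc x y) as Hc.
  pose proof (hpow_le _ _ alpha Ha (conj (Cmod_ge_0 _) Hc)) as Hh.
  rewrite hpow_mult in Hh by (try apply Rabs_pos; lra).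
  pose proof (hpow_ge_0 (Rabs (x - y)) alpha). nra.
Qed.

Theorem theorem3 (K alpha : R) (f : C -> C) (U : C -> R)
  (HK : 1 <= K) (Halpha : 0 < alpha < 1)
  (Hf : harmonic_quasiregular K f)
  (HU : continuous_extension (fun z => Re (f z)) U)
  (HUalpha : Lambda alpha (fun theta => RtoC (U (expi theta)))) :
  exists V : C -> R,
    continuous_extension (fun z => Im (f z)) V /\
    Lambda alpha (fun theta => RtoC (V (expi theta))).
Proof.
  destruct Hf as (Hharm & h & g & omega & Hdec & Hdil & _ & Hk).
  destruct HU as [HUc HUe].
  destruct (Lambda_chord alpha U (proj1 Halpha) HUalpha) as (A & HA & HUA).
  destruct (gradient_growth alpha A U Halpha HA HUc
    (fun p => laplacian_of_harmonic _ U p (proj1 Hharm) HUe) HUA) as (B & HB & Hgrad).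
  pose proof Hdec as (Hh & Hg & _ & Hfe).
  assert (Hkpos : 0 <= (K - 1) / (K + 1)).
  { unfold Rdiv. apply Rmult_le_pos; [lra|]. left. apply Rinv_0_lt_compat. lra. }
  pose proof (dilatation_bound f h g omega _ Hharm Hdec Hdil Hkpos Hk) as Hdb.
  set (G := fun z : C => (h z - g z)%C).
  set (G' := fun z : C => (C_derive h z - C_derive g z)%C).
  assert (HG : forall p, disk p -> @is_derive C_AbsRing C_NormedModule G p (G' p)).
  { intros p Hp. exact (is_derive_minus (K := C_AbsRing) (V := C_NormedModule) h g p _ _
      (analytic_derive h p Hh Hp) (analytic_derive g p Hg Hp)). }
  assert (Hgrow : forall p, disk p -> Cmod (G' p) <= K * (2 * B) * Rpower (1 - Cmod p) (alpha - 1)).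
  { intros p Hp.
    apply Rle_trans with (1 := quasiregular_gradient K _ _ HK (Hdb p Hp)).
    rewrite Rmult_assoc. apply Rmult_le_compat_l; [lra|].
    apply Rle_trans with (1 := Cmod_le_parts _).
    destruct (cr_derive_plus h g p _ _ (analytic_cr h p Hh Hp) (analytic_cr g p Hg Hp)) as [[X _] [Y _]].
    assert (Eloc : locally p (fun q => Re (h q + g q)%C = U q)).
    { apply (locally_disk_eq (fun q => Re (h q + g q)%C)); [exact Hp|]. intros q Hq.
      rewrite (HUe q Hq), (Hfe q Hq). destruct (h q), (g q). reflexivity. }
    destruct (Hgrad p _ _ Hp (is_derive_ext_loc _ _ _ _ (locally_line_x _ p Eloc) X)
      (is_derive_ext_loc _ _ _ _ (locally_line_y _ p Eloc) Y)) as [Bx By].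
    rewrite Rabs_Ropp in By. lra. }
  assert (HB' : 0 <= K * (2 * B)) by nra.
  pose proof (hardy_littlewood alpha (K * (2 * B)) G G' Halpha HB' HG Hgrow) as HGh.
  set (A' := 2 * (K * (2 * B)) / alpha + K * (2 * B)) in *.
  assert (HA' : 0 <= A').
  { unfold A', Rdiv. apply Rplus_le_le_0_compat; [|lra].
    apply Rmult_le_pos; [lra|]. left. apply Rinv_0_lt_compat. lra. }
  assert (D0 : disk 0) by (unfold disk; rewrite Cmod_0; lra).
  destruct (holder_extension alpha A' disk (fun z => Im (G z)) Halpha HA' D0 HGh) as (V & HVe & HVh).
  exists V. split.
  - split.
    + apply (continuous_on_of_holder alpha A'); trivial. lra.
    + intros z Hz. rewrite (HVe z Hz), (Hfe z Hz). unfold G. destruct (h z), (g z). reflexivity.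
  - apply (chord_Lambda alpha A'); trivial. lra.
Qed.
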